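(* Let $G$ be a compact connected semisimple Lie group with Lie algebra $\mathfrak g$ of dimension $n$ and bi-invariant Riemannian metric $\langle\cdot,\cdot\rangle$, let $\{A_1,\dots,A_n\}$ be a fixed orthonormal basis of $\mathfrak g$, and let $\eta\in\mathfrak g^*$. The functions $l_{i+1}:\mathcal O_\eta\times\mathfrak g\times\mathfrak g^*\to\mathbb R$, $i=1,\dots,n$, defined by $$l_{i+1}(\theta,Y,\xi)=(\theta+\mathrm{ad}^*_Y\xi)(A_i)$$ are integrals of motion of the Hamiltonian system $(\mathcal O_\eta\times\mathfrak g\times\mathfrak g^*,\bar\Omega_\eta,h)$, $h(\theta,Y,\xi)=\theta(Y)+\tfrac12\xi(X_\xi)$; that is, $dl_{i+1}(X_h)=0$ everywhere, where $X_h$ is the Hamiltonian vector field of $h$.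
   Context: Conventions: $\mathrm{Ad}^*_x\xi=\xi\circ\mathrm{Ad}_x$, $\mathrm{ad}_YZ=[Y,Z]$, $\mathrm{ad}^*_Y\xi=\xi\circ\mathrm{ad}_Y$ for $\xi\in\mathfrak g^*$; $X_\xi\in\mathfrak g$ is defined by $\xi(Y)=\langle X_\xi,Y\rangle$ for all $Y\in\mathfrak g$. $\mathcal O_\eta=\{\mathrm{Ad}^*_x\eta:x\in G\}$ is the coadjoint orbit; its tangent vectors are regarded as elements of $\mathfrak g^*$. Hamiltonian vector fields are defined by $i_{X_f}\omega=df$. The symplectic form $\bar\Omega_\eta$: $G\times\mathfrak g$ is the Lie group with product $(x,Y)(g,Z)=(xg,\mathrm{Ad}_{g^{-1}}Y+Z)$; its cotangent bundle is left-trivialized by $\rho(\alpha_x,Y,\xi)=(x,Y,T_e^*L_x\alpha_x+\mathrm{ad}^*_Y\xi,\xi)\in G\times\mathfrak g\times\mathfrak g^*\times\mathfrak g^*$ and $\Omega=(\rho^{-1})^*\Omega_1$, $\Omega_1$ the canonical symplectic form (locally $\sum dq^i\wedge dp_i$). $G$ acts by $(gx,Y,\mu,\xi)$ with momentum map $J(x,Y,\mu,\xi)=\mathrm{Ad}^*_{x^{-1}}(\mu-\mathrm{ad}^*_Y\xi)$; with $G_\eta=\{g:\mathrm{Ad}^*_{g^{-1}}\eta=\eta\}$ the quotient $J^{-1}(\eta)/G_\eta$ has the Marsden–Weinstein reduced form $\Omega_\eta$, and $\bar\Omega_\eta$ is its transport to $\mathcal O_\eta\times\mathfrak g\times\mathfrak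 g^*$ by the diffeomorphism $[(x,Y,\mathrm{Ad}^*_x\eta+\mathrm{ad}^*_Y\xi,\xi)]\mapsto(\mathrm{Ad}^*_x\eta,Y,\xi)$. The Hamiltonian vector field of $h$ is $X_h(\theta,Y,\xi)=(\mathrm{ad}^*_Y\theta,X_\xi,-\theta)$. *)

(* Defs.v *)
From HB Require Import structures.
From mathcomp Require Import all_boot all_order all_algebra.
From mathcomp Require Import all_classical all_reals all_analysis.
Set Implicit Arguments.
Unset Strict Implicit.
Unset Printing Implicit Defensive.
Import Order.TTheory GRing.Theory Num.Theory.
Import numFieldNormedType.Exports.
Local Open Scope classical_set_scope.
Local Open Scope ring_scope.

(** C^k on an open set [U]: in finite dimension, continuity of all iterated
    directional derivatives up to order [k]. *)
Fixpoint Ck (R : realType) (V W : normedModType R) (k : nat) (U : set V)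
    (f : V -> W) : Prop :=
  if k is k'.+1 then
    (forall x, U x -> differentiable f x) /\
    (forall v, Ck k' U (fun x => 'd f x v))
  else forall x, U x -> {for x, continuous f}.

Definition smooth_on (R : realType) (V W : normedModType R) (U : set V)
    (f : V -> W) : Prop :=
  forall k, Ck k U f.

Definition smooth_near (R : realType) (V W : normedModType R) (x : V)
    (f : V -> W) : Prop :=
  exists2 U : set V, open U /\ U x & smooth_on U f.

(** An atlas is given by choosing, for every point [x], one of its charts around
    [x]: [chart x] is a homeomorphism from the open set [chart_dom x] onto an
    open subset of R^n, with inverse [chart_inv x]; the values of [chart x] and
    [chart_inv x] outside these sets are irrelevant. *)
HB.mixin Record isSmoothManifold (R : realType) (n : nat) M
    of Topological M := {
  chart_dom : M -> set M;
  chart : M -> M -> 'rV[R]_n;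
  chart_inv : M -> 'rV[R]_n -> M;
  manifold_hausdorff : hausdorff_space M;
  manifold_second_countable : @second_countable M;
  chart_dom_open : forall x, open (chart_dom x);
  chart_dom_center : forall x, chart_dom x x;
  chart_img_open : forall x, open (chart x @` chart_dom x);
  chartK : forall x y, chart_dom x y -> chart_inv x (chart x y) = y;
  chart_continuous : forall x y, chart_dom x y -> {for y, continuous (chart x)};
  chart_inv_continuous : forall x q, (chart x @` chart_dom x) q ->
    {for q, continuous (chart_inv x)};
  chart_transition_smooth : forall x y,
    smooth_on (chart x @` (chart_dom x `&` chart_dom y))
      (chart y \o chart_inv x)
}.

#[short(type="smoothManifoldType")]
HB.structure Definition SmoothManifold (R : realType) (n : nat) :=
  { M of Topological M & isSmoothManifold R n M }.

HB.mixin Record isLieGroup (R : realType) (n : nat) G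
    of SmoothManifold R n G & Group G := {
  mulg_continuous : continuous (fun p : G * G => (p.1 * p.2)%g);
  invg_continuous : continuous (fun x : G => (x^-1)%g);
  mulg_smooth : forall x y : G,
    smooth_near (chart x x, chart y y)
      (fun q : 'rV[R]_n * 'rV[R]_n =>
         chart (x * y)%g (chart_inv x q.1 * chart_inv y q.2)%g : 'rV[R]_n);
  invg_smooth : forall x : G,
    smooth_near (chart x x)
      (fun q : 'rV[R]_n => chart (x^-1)%g (chart_inv x q)^-1%g : 'rV[R]_n)
}.

#[short(type="lieGroupType")]
HB.structure Definition LieGroup (R : realType) (n : nat) :=
  { G of SmoothManifold R n G & Group G & isLieGroup R n G }.

(** The tangent space at [x] is R^n, read in the chart [chart x]. *)
Definition tangent_map (R : realType) (m n : nat) (M : smoothManifoldType R m)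
    (N : smoothManifoldType R n) (f : M -> N) (x : M) (v : 'rV[R]_m) :
    'rV[R]_n :=
  'd (fun q : 'rV[R]_m => chart (f x) (f (chart_inv x q)) : 'rV[R]_n)
    (chart x x) v.

(** The tangent vector at the point [y] of coordinates [q] in [chart x] whose
    components in [chart x] are [v]; as all tangent vectors at [y], it is read in
    [chart y]. *)
Definition chart_vector (R : realType) (n : nat) (M : smoothManifoldType R n)
    (x : M) (q v : 'rV[R]_n) : 'rV[R]_n :=
  'd (fun q' : 'rV[R]_n => chart (chart_inv x q) (chart_inv x q') : 'rV[R]_n)
    q v.

Record riemannian_metric (R : realType) (n : nat) (M : smoothManifoldType R n) :=
  RiemannianMetric {
    metric :> M -> 'rV[R]_n -> 'rV[R]_n -> R;
    metric_sym : forall x u v, metric x u v = metric x v u;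
    metric_linear : forall x u a v w,
      metric x u (a *: v + w) = a * metric x u v + metric x u w;
    metric_pos : forall x v, v != 0 -> 0 < metric x v v;
    metric_smooth : forall x u v,
      smooth_on (chart x @` chart_dom x)
        (fun q : 'rV[R]_n => metric (chart_inv x q)
           (chart_vector x q u) (chart_vector x q v) : R^o)
  }.

(** Covectors on R^n are column vectors. *)
Definition dpair (R : realType) (n : nat) (xi : 'cV[R]_n) (Y : 'rV[R]_n) : R :=
  (Y *m xi) 0 0.

Definition covector (R : realType) (n : nat) (f : 'rV[R]_n -> R) : 'cV[R]_n :=
  \col_i f (delta_mx 0 i).

Section LieGroup.
Context {R : realType} {n : nat} (G : lieGroupType R n).
Implicit Types (x : G) (Y Z : 'rV[R]_n) (xi eta theta mu : 'cV[R]_n).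

Definition bi_invariant (g : riemannian_metric G) : Prop :=
  forall (a x : G) (u v : 'rV[R]_n),
    g (a * x)%g (tangent_map (fun y : G => a * y)%g x u)
      (tangent_map (fun y : G => a * y)%g x v) = g x u v /\
    g (x * a)%g (tangent_map (fun y : G => y * a)%g x u)
      (tangent_map (fun y : G => y * a)%g x v) = g x u v.

Definition Ad x Y : 'rV[R]_n := tangent_map (fun y : G => x * y * x^-1)%g 1%g Y.

(** The Lie bracket of T_e G is the derivative of [Ad] at the identity. *)
Definition ad Y Z : 'rV[R]_n :=
  'd (fun q : 'rV[R]_n => Ad (chart_inv (1%g : G) q) Z) (chart (1%g : G) 1%g) Y.

Definition coAd x xi : 'cV[R]_n := covector (fun Y => dpair xi (Ad x Y)).

Definition coad Y xi : 'cV[R]_n := covector (fun Z => dpair xi (ad Y Z)).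

Definition lie_ideal (V : {vspace 'rV[R]_n}) : Prop :=
  forall Y Z, Z \in V -> ad Y Z \in V.

Definition derived_subalgebra (V : {vspace 'rV[R]_n}) : {vspace 'rV[R]_n} :=
  <<[seq ad Y Z | Y <- vbasis V, Z <- vbasis V]>>%VS.

Definition lie_solvable (V : {vspace 'rV[R]_n}) : Prop :=
  exists k, iter k derived_subalgebra V = 0%VS.

Definition semisimple : Prop :=
  forall V : {vspace 'rV[R]_n}, lie_ideal V -> lie_solvable V -> V = 0%VS.

Definition orthonormal_basis (g : riemannian_metric G) (A : 'I_n -> 'rV[R]_n) :
    Prop :=
  basis_of fullv [tuple A i | i < n] /\
  forall i j, g 1%g (A i) (A j) = (i == j)%:R.

Definition sharp (g : riemannian_metric G) xi : 'rV[R]_n :=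
  xget 0 [set X | forall Y, dpair xi Y = g 1%g X Y].

(** The left-trivialized cotangent bundle of G x g: points (x, Y, mu, xi), with
    tangent vectors read in [chart x] for the first component. *)
Definition bundle : Type := (G * 'rV[R]_n * 'cV[R]_n * 'cV[R]_n)%type.
Definition bundle_tangent := ('rV[R]_n * 'rV[R]_n * 'cV[R]_n * 'cV[R]_n)%type.

Definition bundle_diff (W : normedModType R) (f : bundle -> W) (m : bundle)
    (w : bundle_tangent) : W :=
  let: (x, Y, mu, xi) := m in
  'd (fun z : bundle_tangent => f (chart_inv x z.1.1.1, z.1.1.2, z.1.2, z.2))
    (chart x x, Y, mu, xi) w.

(** Points (alpha_x, Y, xi) of the cotangent bundle of G x g, where alpha_x is
    the pair of x and a covector on T_x G. *)
Definition cotangent := ((G * 'cV[R]_n) * 'rV[R]_n * 'cV[R]_n)%type.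

(** Inverse of rho (alpha_x, Y, xi) = (x, Y, T_e^* L_x alpha_x + ad^*_Y xi, xi),
    using that T_e^* L_x has inverse T_x^* L_(x^-1). *)
Definition rho_inv (m : bundle) : cotangent :=
  let: (x, Y, mu, xi) := m in
  ((x, covector (fun v => dpair (mu - coad Y xi)
                   (tangent_map (fun y : G => x^-1 * y)%g x v))), Y, xi).

(** Canonical coordinates ((q, Y), (p, xi)) of the cotangent bundle of G x g
    induced by the chart [chart x0] of G and linear coordinates on g: p is the
    covector alpha_x expressed in the coordinates [chart x0]. *)
Definition coords := (('rV[R]_n * 'rV[R]_n) * ('cV[R]_n * 'cV[R]_n))%type.

Definition canonical_coords (x0 : G) (c : cotangent) : coords :=
  let: ((x, alpha), Y, xi) := c in
  ((chart x0 x, Y),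
   (covector (fun v => dpair alpha (chart_vector x0 (chart x0 x) v)), xi)).

(** The form sum_i dq^i /\ dp_i. *)
Definition std_form (a b : coords) : R :=
  (dpair b.2.1 a.1.1 + dpair b.2.2 a.1.2)
  - (dpair a.2.1 b.1.1 + dpair a.2.2 b.1.2).

(** The pullback of the canonical form by rho^-1. *)
Definition Omega (m : bundle) (w1 w2 : bundle_tangent) : R :=
  let D := bundle_diff
    (fun m' => canonical_coords m.1.1.1 (rho_inv m') : coords) m in
  std_form (D w1) (D w2).

Definition momentum (m : bundle) : 'cV[R]_n :=
  let: (x, Y, mu, xi) := m in coAd x^-1%g (mu - coad Y xi).

Definition orbit eta : set 'cV[R]_n := [set coAd x eta | x in [set: G]].

(** T_theta O_eta as a subspace of g^*: the image of the tangent map, at any x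
    with Ad^*_x eta = theta, of the submersion x |-> Ad^*_x eta of G onto
    O_eta. *)
Definition orbit_tangent eta theta : set 'cV[R]_n :=
  [set delta | exists x v, coAd x eta = theta /\
    delta = 'd (fun q : 'rV[R]_n => coAd (chart_inv x q) eta) (chart x x) v].

Definition ambient := ('cV[R]_n * 'rV[R]_n * 'cV[R]_n)%type.

(** O_eta x g x g^* and its tangent spaces, inside g^* x g x g^*. *)
Definition phase_space eta : set ambient := [set p | orbit eta p.1.1].

Definition phase_tangent eta (p : ambient) : set ambient :=
  [set u | orbit_tangent eta p.1.1 u.1.1].

(** On J^-1(eta), this is the quotient map onto J^-1(eta) / G_eta followed by the
    diffeomorphism with O_eta x g x g^*. *)
Definition reduction eta (m : bundle) : ambient :=
  let: (x, Y, mu, xi) := m in (coAd x eta, Y, xi).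

(** The Marsden-Weinstein reduced form, carried to O_eta x g x g^*: its value on
    the images of tangent vectors [w1], [w2] of J^-1(eta) at [m] (the kernel of
    dJ) is [Omega m w1 w2]. *)
Definition Omega_bar eta (p u1 u2 : ambient) : R :=
  xget 0 [set r | exists m w1 w2,
    [/\ momentum m = eta, reduction eta m = p,
        bundle_diff momentum m w1 = 0 /\ bundle_diff momentum m w2 = 0,
        bundle_diff (reduction eta : bundle -> ambient) m w1 = u1 /\
        bundle_diff (reduction eta : bundle -> ambient) m w2 = u2
      & r = Omega m w1 w2]].

Definition hamiltonian_vector_field eta (f : ambient -> R) (X : ambient -> ambient)
    : Prop :=
  forall p, phase_space eta p ->
    phase_tangent eta p (X p) /\
    forall u, phase_tangent eta p u ->
      Omega_bar eta p (X p) u = 'd (f : ambient -> R^o) p u.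

Definition energy (g : riemannian_metric G) (p : ambient) : R :=
  let: (theta, Y, xi) := p in dpair theta Y + 2^-1 * dpair xi (sharp g xi).

(** [integral_fun A i] is l_(i+2) when indices [i : 'I_n] start from 0. *)
Definition integral_fun (A : 'I_n -> 'rV[R]_n) (i : 'I_n) (p : ambient) : R :=
  let: (theta, Y, xi) := p in dpair (theta + coad Y xi) (A i).

End LieGroup.

(* Main.v *)
From HB Require Import structures.
From mathcomp Require Import all_boot all_order all_algebra.
From mathcomp Require Import all_classical all_reals all_analysis.
From mathcomp Require Import ring.
Require Import Defs.
Set Implicit Arguments.
Unset Strict Implicit.
Unset Printing Implicit Defensive.
Import Order.TTheory GRing.Theory Num.Theory.
Import numFieldNormedType.Exports.
Local Open Scope classical_set_scope.
Local Open Scope ring_scope.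

(** On J^-1(eta) the covector mu - ad^*_Y xi equals theta = Ad^*_x eta, so in
    canonical coordinates the momentum conjugate to x is theta composed with the
    left Maurer-Cartan form. Differentiating along ker dJ and using the
    Maurer-Cartan equation, the reduced form is
      -theta([Z1, Z2]) + zeta2(U1) - zeta1(U2)
    on the vectors (ad^*_Zi theta, Ui, zetai). Nondegeneracy then forces
    X_h = (ad^*_Y theta, X_xi, -theta), and dl(X_h) at A reduces to
    xi([X_xi, A]) = - <X_xi, [A, X_xi]>, which vanishes since Ad is isometric.
    As the bracket is the derivative of Ad, both its antisymmetry and the
    Maurer-Cartan equation come from the symmetry of second derivatives applied
    to the product read in charts. *)

(** * Differential calculus *)

Section Calculus.
Context {R : realType}.
Implicit Types U V W : normedModType R.

(** Two encodings shape the work. The differential ['d] is total, and chart expressions carry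
    meaning only near their centre. Derivatives therefore travel as [is_diff] facts, which hold
    differentiability together with an explicit differential, and identities between group elements
    are differentiated as equalities of germs. The form [Omega_bar] is a value picked by [xget]
    among those produced by all lifts to [ker dJ]. Evaluating it means exhibiting one lift and
    proving that all lifts agree, which is the well-definedness of the Marsden-Weinstein form. It
    also explains why the bracket term must finally be written through the tangent vector
    [delta = ad^*_Z theta]: a lift fixes [Z] only modulo the stabilizer of [theta]. *)

Lemma diff_remainder V W (f : V -> W) x : differentiable f x ->
  forall e : R, 0 < e -> \forall h \near 0, `|f (h + x) - f x - 'd f x h| <= e * `|h|.
Proof.
move=> /diff_locallyP [_ /eqaddoP fo] e e0.
move: (fo e e0); apply: filterS => h /=.
by rewrite -[(_ - (_ + _)) h]/(f (h + x) - (f x + 'd f x h)) opprD addrA.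
Qed.

(** The expansion defining a differential sees only the germ, and differentials are unique. Since
    chart formulas hold only near the centre, most derivatives below are computed on a composite of
    known pieces and moved here to the intended function. *)
Lemma near_eq_is_diff V W (f g df : V -> W) x :
  (\forall y \near x, f y = g y) -> is_diff x f df -> is_diff x g df.
Proof.
move=> fg [fx dfE].
have gE : g \o shift x = cst (g x) + 'd f x +o_ 0 id.
  apply/eqaddoP => e e0.
  have fg0 : \forall h \near (0:V), f (h + x) = g (h + x).
    have : h + x @[h --> (0:V)] --> 0 + x.
      by apply: cvgD; [exact: cvg_id|exact: cvg_cst].
    by rewrite add0r => /(_ _ fg).
  near=> h; rewrite -[(_ - (_ + _)) h]/(g (h + x) - (g x + 'd f x h)).
  rewrite -(nbhs_singleton fg) opprD addrA.
  have <- : f (h + x) = g (h + x) by near: h.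
  by near: h; exact: diff_remainder.
have dE := diff_unique (diff_continuous fx) gE.
split; last by rewrite dE dfE.
by apply/diff_locallyP; rewrite dE; split => //; exact: diff_continuous.
Unshelve. all: by end_near. Qed.

Lemma diff_eqf V W (f df : V -> W) x v : is_diff x f df -> 'd f x v = df v.
Proof. by case=> _ ->. Qed.

Lemma is_diff_unique V W (f g df dg : V -> W) x :
  (\forall y \near x, f y = g y) -> is_diff x f df -> is_diff x g dg ->
  forall v, dg v = df v.
Proof. by move=> fg /(near_eq_is_diff fg)[_ <-] [_ <-]. Qed.

Lemma is_diff_zero V W (c : W) x : is_diff x (fun _ : V => c) (fun=> 0).
Proof. exact: is_diff_cst. Qed.

(** The base point of the outer map is a separate variable, because values such as a product of
    chart centres equal the expected centre only up to a rewriting that is awkward inside a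
    differential. *)
Lemma is_diff_comp_at U V W (f df : U -> V) (g dg : V -> W) x y :
  is_diff x f df -> is_diff y g dg -> f x = y -> is_diff x (g \o f) (dg \o df).
Proof. by move=> fx + fxy; case: _ / fxy => gx; exact: is_diff_comp. Qed.

Lemma is_diff_coord V m k (f df : V -> 'M[R]_(m, k)) x i j :
  is_diff x f df -> is_diff x (fun y => f y i j : R^o) (fun v => df v i j).
Proof.
move=> dfx.
pose c : 'M[R]_(m, k) -> R^o := fun M => M i j.
have cl : linear c by move=> a M N; rewrite /c !mxE.
pose lc := GRing.isLinear.Build _ _ _ _ c cl.
pose C : {linear 'M[R]_(m, k) -> R^o} := HB.pack c lc.
have Cc : continuous C by move=> M; exact: coord_continuous.
have dC : is_diff (f x) C C by split; [exact: linear_differentiable|exact: diff_lin].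
exact: (is_diff_comp dfx dC).
Qed.

Lemma is_diff_bigsum V W (I : finType) (f df : I -> V -> W) x :
  (forall i, is_diff x (f i) (df i)) ->
  is_diff x (fun y => \sum_i f i y) (fun v => \sum_i df i v).
Proof.
move=> H.
have E (h : I -> V -> W) : (fun y => \sum_i h i y) = \sum_i h i.
  by apply/funext => y; rewrite fct_sumE.
rewrite !E; elim/big_rec2: _ => [|i f1 f2 _ IH]; first exact: is_diff_cst.
exact: is_diffD.
Qed.

Lemma is_diff_scale V W (k dk : V -> R^o) (f df : V -> W) x :
  is_diff x k dk -> is_diff x f df ->
  is_diff x (fun y => k y *: f y) (fun v => k x *: df v + dk v *: f x).
Proof.
move=> kx fx.
pose s : R^o -> W -> W := fun a w => a *: w.
have sl : bilinear_for
    (GRing.Scale.Law.clone _ _ *:%R _) (GRing.Scale.Law.clone _ _ *:%R _) s.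
  by split=> [w|a] b u v /=; rewrite /s ?scalerDl ?scalerDr ?scalerA // mulrC.
pose sb := bilinear_isBilinear.Build R R^o W W _ _ s sl.
pose S : {bilinear R^o -> W -> W} := HB.pack s sb.
have Sc : continuous (fun p => S p.1 p.2).
  by move=> p; exact: (@scale_continuous _ _ p).
have dS : is_diff (k x, f x) (fun q => S q.1 q.2)
    (fun q => S (k x) q.2 + S q.1 (f x)).
  by apply: DiffDef; [exact: differentiable_bilin|rewrite diff_bilin].
exact: (is_diff_comp (is_diff_pair kx fx) dS).
Qed.

Lemma is_diff_mx V m k (f df : V -> 'M[R]_(m, k)) x :
  (forall i j, is_diff x (fun y => f y i j : R^o) (fun v => df v i j)) ->
  is_diff x f df.
Proof.
move=> H.
have E (h : V -> 'M[R]_(m, k)) : h = (fun y => \sum_i \sum_j h y i j *: delta_mx i j).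
  by apply/funext => y; exact: matrix_sum_delta.
rewrite (E f) (E df); apply: is_diff_bigsum => i; apply: is_diff_bigsum => j.
have := is_diff_scale (H i j) (is_diff_cst (delta_mx i j) x).
congr is_diff_def; apply/funext => v.
by rewrite -[X in _ *: X + _]/(0) scaler0 add0r.
Qed.

Lemma linear_sum_delta m k W (L : 'M[R]_(m, k) -> W) : linear L ->
  forall M, L M = \sum_i \sum_j M i j *: L (delta_mx i j).
Proof.
move=> lL M; pose lc := GRing.isLinear.Build _ _ _ _ L lL.
pose F : {linear 'M[R]_(m, k) -> W} := HB.pack L lc.
rewrite -[L]/(F : _ -> _) {1}(matrix_sum_delta M) linear_sum.
by apply: eq_bigr => i _; rewrite linear_sum; apply: eq_bigr => j _; rewrite linearZ.
Qed.

(** Leibniz rule for linear maps [B y] applied to a moving argument. The argument lives in a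
    finite-dimensional space, so it suffices to differentiate [B] on each fixed [N]: expansion in
    elementary matrices reduces the claim to products of a scalar and a vector. *)
Lemma is_diff_apply V W m k (B : V -> 'M[R]_(m, k) -> W)
    (dB : 'M[R]_(m, k) -> V -> W) (u du : V -> 'M[R]_(m, k)) x M :
  (forall y, linear (B y)) -> (forall N, is_diff x (B ^~ N) (dB N)) ->
  is_diff x u du -> u x = M ->
  is_diff x (fun y => B y (u y)) (fun v => dB M v + B x (du v)).
Proof.
move=> lB dBx dux <-.
have main (w dw : V -> 'M[R]_(m, k)) : is_diff x w dw ->
    is_diff x (fun y => B y (w y)) (fun v => \sum_i \sum_j
      (w x i j *: dB (delta_mx i j) v + dw v i j *: B x (delta_mx i j))).
  move=> dwx.
  have -> : (fun y => B y (w y)) =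
      (fun y => \sum_i \sum_j w y i j *: B y (delta_mx i j)).
    by apply/funext => y; rewrite (linear_sum_delta (lB y)).
  apply: is_diff_bigsum => i; apply: is_diff_bigsum => j.
  by apply: is_diff_scale => //; exact: is_diff_coord.
have := main _ _ dux; congr is_diff_def; apply/funext => v.
(* The terms in [dB] are recognized by applying [main] to the constant argument [u x]; linearity of
   [dB] in its matrix argument comes out of this comparison. *)
have [_ <-] := dBx (u x); have [_ ->] := main _ _ (is_diff_cst (u x) x).
rewrite (linear_sum_delta (lB x) (du v)) -big_split; apply: eq_bigr => i _ /=.
rewrite -big_split; apply: eq_bigr => j _ /=.
by rewrite -[(0 : V -> 'M[R]_(m, k)) v]/(0) mxE scale0r addr0.
Qed.

Lemma is_diff_linear_mx m k W (L : 'M[R]_(m, k) -> W) M : linear L -> is_diff M L L.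
Proof.
move=> lL; have := is_diff_apply (B := fun=> L) (fun=> lL)
  (fun N => is_diff_zero (L N) M) (is_diff_id M) erefl.
by congr is_diff_def; apply/funext => v; rewrite add0r.
Qed.

Lemma is_diff_fst V W (p : V * W) : is_diff p (fst : V * W -> V) fst.
Proof.
have fc : continuous (fst : V * W -> V) by move=> q; exact: cvg_fst.
by split; [exact: linear_differentiable|exact: diff_lin].
Qed.

Lemma is_diff_snd V W (p : V * W) : is_diff p (snd : V * W -> W) snd.
Proof.
have fc : continuous (snd : V * W -> W) by move=> q; exact: cvg_snd.
by split; [exact: linear_differentiable|exact: diff_lin].
Qed.

(** * Symmetry of second derivatives *)

Lemma MVT_line V (f : V -> R) (x v : V) (h : R) : 0 < h ->
  (forall t, 0 <= t <= h -> differentiable f (x + t *: v)) ->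
  exists2 c, 0 < c < h & f (x + h *: v) - f x = h * 'd f (x + c *: v) v.
Proof.
move=> h0 df.
have dl t : is_diff t (fun s : R^o => x + s *: v) (fun s => s *: v).
  have := is_diffD (is_diff_cst x t) (is_diff_scalel t v).
  by congr is_diff_def; apply/funext => s; rewrite -[LHS]/(0 + s *: v) add0r.
have dfl t : 0 <= t <= h ->
    is_derive (t : R^o) 1 (fun s : R^o => f (x + s *: v) : R^o) ('d f (x + t *: v) v).
  move=> th.
  have D := is_diff_comp (dl t) (differentiableP (df t th)).
  split; first by apply: diff_derivable; case: D.
  by rewrite deriveE; [case: D => _ -> /=; rewrite scale1r | case: D].
have [||c ch E] := @MVT R (fun s : R => f (x + s *: v))
    (fun s => 'd f (x + s *: v) v) 0 h h0.
- by move=> t; rewrite in_itv /= => /andP[t0 th]; apply: dfl; rewrite !ltW.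
- apply: derivable_within_continuous => t; rewrite in_itv /= => th.
  by case: (dfl t th).
- exists c; first by move: ch; rewrite in_itv.
  by move: E; rewrite scale0r addr0 subr0 mulrC.
Qed.

(** The mean value theorem in direction [v], applied to [f (y + h *: w) - f y], turns the second
    difference into [h] times an increment of ['d f _ v]. Differentiability of that map at [x] then
    gives [D (c *: v + h *: w) - D (c *: v)], in which the unknown [c] cancels. *)
Lemma second_difference V (f : V -> R) (x v w : V) :
  (\forall z \near x, differentiable f z) ->
  differentiable (fun z => 'd f z v : R^o) x ->
  forall e : R, 0 < e -> exists2 d : R, 0 < d & forall h, 0 < h < d ->
  `|f (x + h *: v + h *: w) - f (x + h *: v) - f (x + h *: w) + f x
    - h ^+ 2 * 'd (fun z => 'd f z v : R^o) x w| <= e * h ^+ 2.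
Proof.
move=> dfx dvx e e0.
(* [h * N] bounds every [s *: v + t *: w] with [s], [t] in [[0, h]]; the summand [1] keeps [N]
   positive when both vectors vanish. *)
pose N := `|v| + `|w| + 1.
have N0 : 0 < N by rewrite ltr_wpDl // addr_ge0.
(* Two remainders of size [e / (2 * N) * (h * N)], multiplied by the [h] of the mean value theorem,
   add up to [e * h ^+ 2]. *)
have e'0 : 0 < e / (2 * N) by rewrite divr_gt0 // mulr_gt0.
have /nbhs_ballP[r1 /= r10 B1] := dfx.
have := diff_remainder dvx e'0; move: ('d (fun z => 'd f z v : R^o) x) => D /nbhs_ballP[r2 /= r20 B2].
exists (Num.min r1 r2 / N); first by rewrite divr_gt0 // lt_min r10.
move=> h /andP[h0]; rewrite ltr_pdivlMr // lt_min => /andP[hr1 hr2].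
have bound (s t : R) : 0 <= s <= h -> 0 <= t <= h -> `|s *: v + t *: w| <= h * N.
  move=> /andP[s0 sh] /andP[t0 th]; apply: le_trans (ler_normD _ _) _.
  rewrite !normrZ !ger0_norm // /N !mulrDr mulr1 -[X in X <= _]addr0.
  by rewrite !lerD ?ler_wpM2r // ltW.
have diffst (s t : R) : 0 <= s <= h -> 0 <= t <= h -> differentiable f (x + s *: v + t *: w).
  move=> sh th; apply: B1; rewrite -ball_normE /ball_ /= -addrA opprD addrA subrr.
  by rewrite sub0r normrN; apply: le_lt_trans (bound _ _ sh th) _.
have remst (s t : R) : 0 <= s <= h -> 0 <= t <= h ->
    `|'d f (x + s *: v + t *: w) v - 'd f x v -
      D (s *: v + t *: w)| <= e / (2 * N) * (h * N).
  move=> sh th.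
  have /B2 : ball 0 r2 (s *: v + t *: w).
    rewrite -ball_normE /ball_ /= sub0r normrN.
    by apply: le_lt_trans (bound _ _ sh th) _.
  rewrite /= [s *: v + t *: w + x]addrC addrA => /le_trans; apply.
  by rewrite ler_pM2l //; exact: bound.
have h0h : (0 : R) <= 0 <= h by rewrite lexx ltW.
have hhh : 0 <= h <= h by rewrite lexx ltW.
have dF (t : R) : 0 <= t <= h -> is_diff (x + t *: v) (fun y => f (y + h *: w) - f y : R^o)
    (fun u => 'd f (x + t *: v + h *: w) u - 'd f (x + t *: v) u).
  move=> th.
  apply: (@is_diffB _ _ _ (fun y => f (y + h *: w) : R^o) (f : V -> R^o)
    ('d f (x + t *: v + h *: w)) ('d f (x + t *: v))).
    have ds : is_diff (x + t *: v) (fun y => y + h *: w) id.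
      have := is_diffD (is_diff_id (x + t *: v)) (is_diff_cst (h *: w) (x + t *: v)).
      by congr is_diff_def; apply/funext => s; rewrite -[LHS]/(s + 0) addr0.
    exact: (is_diff_comp ds (differentiableP (diffst t h th hhh))).
  by apply: differentiableP; have := diffst t 0 th h0h; rewrite scale0r addr0.
have [t th|c /andP[c0 ch]] := @MVT_line V (fun y => f (y + h *: w) - f y) x v h h0.
  by case: (dF t th).
have chh : 0 <= c <= h by rewrite !ltW.
have [_ ->] := dF c chh.
move=> E.
have -> : f (x + h *: v + h *: w) - f (x + h *: v) - f (x + h *: w) + f x =
    h * ('d f (x + c *: v + h *: w) v - 'd f (x + c *: v) v).
  by rewrite -E; ring.
have := remst c h chh hhh; have := remst c 0 chh h0h.
rewrite scale0r !addr0 (linearD D) (linearZ_LR D h w) /=.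
move: ('d f (x + c *: v) v) ('d f (x + c *: v + h *: w) v) ('d f x v) => a b b0.
move: (D (c *: v)) (D w) => L L'.
rewrite -[h *: L']/(h * L').
have -> : e / (2 * N) * (h * N) = e * h / 2.
  by field; rewrite gt_eqF.
move=> H1 H2.
have -> : h * (b - a) - h ^+ 2 * L' = h * ((b - b0 - (L + h * L')) - (a - b0 - L)).
  by ring.
rewrite normrM gtr0_norm //.
have -> : e * h ^+ 2 = h * (e * h / 2 + e * h / 2) by field.
rewrite ler_pM2l //; apply: le_trans (ler_normB _ _) _; exact: lerD.
Qed.

(** The second difference is symmetric in [v] and [w], and after division by [h ^+ 2] it
    approximates both iterated derivatives. *)
Lemma second_diff_symR V (f : V -> R) (x v w : V) :
  (\forall z \near x, differentiable f z) ->
  (forall u, differentiable (fun z => 'd f z u : R^o) x) ->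
  'd (fun z => 'd f z v : R^o) x w = 'd (fun z => 'd f z w : R^o) x v.
Proof.
move=> dfx dux; apply/eqP; rewrite -subr_eq0 -normr_le0; apply/ler_addgt0Pl => e e0.
have e20 : 0 < e / 2 by rewrite divr_gt0.
have [d1 d10 H1] := second_difference w dfx (dux v) e20.
have [d2 d20 H2] := second_difference v dfx (dux w) e20.
pose h := Num.min d1 d2 / 2.
have m0 : 0 < Num.min d1 d2 by rewrite lt_min d10.
have h0 : 0 < h by rewrite divr_gt0.
have hm : h < Num.min d1 d2 by rewrite /h ltr_pdivrMr // ltr_pMr // ltr1n.
move: hm; rewrite lt_min => /andP[hd1 hd2].
have {}H1 := H1 h; have {}H2 := H2 h.
rewrite h0 hd1 in H1; rewrite h0 hd2 in H2.
have {}H1 := H1 isT; have {}H2 := H2 isT.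
set a := 'd _ x w in H1 *; set b := 'd _ x v in H2 *.
rewrite [x + h *: w + h *: v]addrAC in H2.
have h20 : 0 < h ^+ 2 by rewrite exprn_gt0.
rewrite addr0 -(ler_pM2l h20) -[in X in X <= _](gtr0_norm h20) -normrM.
set S := f (x + h *: v + h *: w) in H1 H2.
have -> : h ^+ 2 * (a - b) =
  (S - f (x + h *: w) - f (x + h *: v) + f x - h ^+ 2 * b)
  - (S - f (x + h *: v) - f (x + h *: w) + f x - h ^+ 2 * a) by ring.
have -> : h ^+ 2 * e = e / 2 * h ^+ 2 + e / 2 * h ^+ 2 by field.
by apply: le_trans (ler_normB _ _) _; exact: lerD.
Qed.

Lemma second_diff_sym V m k (f : V -> 'M[R]_(m, k)) (x v w : V) :
  (\forall z \near x, differentiable f z) ->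
  (forall u, differentiable (fun z => 'd f z u) x) ->
  'd (fun z => 'd f z v) x w = 'd (fun z => 'd f z w) x v.
Proof.
move=> dfx dux; apply/matrixP => i j.
have c1 z : differentiable f z ->
    is_diff z (fun y => f y i j : R^o) (fun u => 'd f z u i j).
  by move=> /differentiableP; exact: is_diff_coord.
have E u : \forall z \near x, 'd f z u i j = 'd (fun y => f y i j : R^o) z u.
  by near=> z; rewrite (diff_eqf _ (c1 z _)) //; near: z.
have c2 u : is_diff x (fun z => 'd (fun y => f y i j : R^o) z u : R^o)
    (fun t => 'd (fun z => 'd f z u) x t i j).
  apply: near_eq_is_diff (E u) _.
  by apply: is_diff_coord; exact: differentiableP.
have := @second_diff_symR V (fun y => f y i j) x v w.
rewrite (diff_eqf _ (c2 v)) (diff_eqf _ (c2 w)); apply.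
  by near=> z; case: (c1 z _) => //; near: z.
by move=> u; case: (c2 u).
Unshelve. all: by end_near. Qed.

End Calculus.

(** * Charts and translations *)

Lemma smooth_near_diff (R : realType) (V W : normedModType R) (x : V) (f : V -> W) :
  smooth_near x f ->
  (\forall z \near x, differentiable f z) /\
  (forall v, differentiable (fun z => 'd f z v) x).
Proof.
move=> [U [oU Ux] sU]; have [d1 d2] := sU 2%N; split.
  have : nbhs x U by exact: open_nbhs_nbhs.
  by apply: filterS => z /d1.
by move=> v; have [d _] := d2 v; exact: d.
Qed.

Section Manifold.
Context {R : realType} {m : nat} (M : smoothManifoldType R m).
Implicit Types x : M.

Lemma chart_inv_center x : chart_inv x (chart x x) = x.
Proof. by rewrite chartK //; exact: chart_dom_center. Qed.

Lemma chart_img_near x :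
  \forall q \near chart x x, (chart x @` chart_dom x) q.
Proof.
apply: open_nbhs_nbhs; split; first exact: chart_img_open.
by exists x => //; exact: chart_dom_center.
Qed.

Lemma chart_inv_continuous_center x : {for chart x x, continuous (chart_inv x)}.
Proof. by apply: chart_inv_continuous; exists x => //; exact: chart_dom_center. Qed.

Lemma chart_inv_near x :
  \forall q \near chart x x, chart x (chart_inv x q) = q.
Proof.
have := chart_img_near x; apply: filterS => q [y xy <-].
by rewrite chartK.
Qed.

(** Continuity keeps [h s] in the chart domain, which permits passing through coordinates in the
    middle of a composite. *)
Lemma chartK_near (T : topologicalType) (h : T -> M) t x :
  {for t, continuous h} -> h t = x ->
  \forall s \near t, chart_inv x (chart x (h s)) = h s.
Proof.
move=> ht htx.
have : nbhs (h t) (chart_dom x).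
  rewrite htx; apply: open_nbhs_nbhs; split; first exact: chart_dom_open.
  exact: chart_dom_center.
move=> H; have : nbhs t (h @^-1` chart_dom x) := ht _ H.
by apply: filterS => s /= /chartK.
Qed.
End Manifold.

(** Continuity is a separate clause: [chart (f x)] is arbitrary off its domain, so a differentiable
    coordinate expression does not by itself keep [f] close to [f x]. *)
Definition diff_at (R : realType) (m n : nat) (M : smoothManifoldType R m)
    (N : smoothManifoldType R n) (f : M -> N) (x : M) : Prop :=
  {for x, continuous f} /\
  differentiable (fun q : 'rV[R]_m => chart (f x) (f (chart_inv x q)) : 'rV[R]_n)
    (chart x x).

Lemma tangent_map_comp (R : realType) (m n k : nat) (M : smoothManifoldType R m)
    (N : smoothManifoldType R n) (P : smoothManifoldType R k)
    (f : M -> N) (h : N -> P) (x : M) :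
  diff_at f x -> diff_at h (f x) ->
  diff_at (h \o f) x /\
  forall v, tangent_map (h \o f) x v = tangent_map h (f x) (tangent_map f x v).
Proof.
move=> [fc fd] [hc hd].
pose F (q : 'rV[R]_m) : 'rV[R]_n := chart (f x) (f (chart_inv x q)).
pose H (q : 'rV[R]_n) : 'rV[R]_k := chart (h (f x)) (h (chart_inv (f x) q)).
have Fx : F (chart x x) = chart (f x) (f x) by rewrite /F chart_inv_center.
have dF := differentiableP fd.
have dH : is_diff (F (chart x x)) H ('d H (chart (f x) (f x))).
  by rewrite Fx; exact: differentiableP.
have fic : {for chart x x, continuous (f \o chart_inv x)}.
  apply: continuous_comp; first exact: chart_inv_continuous_center.
  by rewrite chart_inv_center.
have E : \forall q \near chart x x,
    (H \o F) q = chart ((h \o f) x) ((h \o f) (chart_inv x q)).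
  have := @chartK_near R n N _ (f \o chart_inv x) (chart x x) (f x) fic.
  rewrite /= chart_inv_center => /(_ erefl); apply: filterS => q /= Eq.
  by rewrite /H /F Eq.
have [D1 D2] := near_eq_is_diff E (is_diff_comp dF dH).
by split; [split=> //; exact: continuous_comp|move=> v; rewrite /tangent_map D2].
Qed.

Lemma tangent_map_id (R : realType) (m : nat) (M : smoothManifoldType R m) (x : M) v :
  tangent_map (fun y : M => y) x v = v.
Proof.
have E : \forall q \near chart x x, id q = chart x (chart_inv x q).
  by have := chart_inv_near x; apply: filterS => q ->.
by have [_ D] := near_eq_is_diff E (is_diff_id _); rewrite /tangent_map D.
Qed.

(** * Translations, conjugations and the adjoint action *)

Section Translations.
Context {R : realType} {n : nat} (G : lieGroupType R n).
Implicit Types (a w x y : G).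

(** The target chart is a parameter [w], used along with a proof of [x * y = w], so that [x^-1 * x]
    can be read directly in the chart at the identity. *)
Definition mul_chart w x y (q : 'rV[R]_n * 'rV[R]_n) : 'rV[R]_n :=
  chart w (chart_inv x q.1 * chart_inv y q.2)%g.

Lemma lmul_continuous a : continuous (fun y : G => a * y)%g.
Proof.
move=> x.
apply: (@continuous_comp _ _ _ (fun y : G => (a, y)) (fun p : G * G => p.1 * p.2)%g).
  by apply: cvg_pair; [exact: cvg_cst|exact: cvg_id].
exact: mulg_continuous.
Qed.

Lemma rmul_continuous a : continuous (fun y : G => y * a)%g.
Proof.
move=> x.
apply: (@continuous_comp _ _ _ (fun y : G => (y, a)) (fun p : G * G => p.1 * p.2)%g).
  by apply: cvg_pair; [exact: cvg_id|exact: cvg_cst].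
exact: mulg_continuous.
Qed.

Lemma mul_chart_diff w x y : (x * y)%g = w ->
  (\forall z \near (chart x x, chart y y), differentiable (mul_chart w x y) z) /\
  (forall v, differentiable (fun z => 'd (mul_chart w x y) z v) (chart x x, chart y y)).
Proof. by move=> <-; apply: smooth_near_diff; exact: mulg_smooth. Qed.

Lemma is_diff_pairr (V W : normedModType R) (a : V) (b : W) :
  is_diff b (fun q => (a, q)) (fun v => (0, v)).
Proof. exact: (is_diff_pair (is_diff_cst a b) (is_diff_id b)). Qed.

Lemma is_diff_pairl (V W : normedModType R) (a : V) (b : W) :
  is_diff a (fun q => (q, b)) (fun v => (v, 0)).
Proof. exact: (is_diff_pair (is_diff_id a) (is_diff_cst b a)). Qed.

Lemma lmul_diff_at a x : diff_at (fun y : G => a * y)%g x.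
Proof.
split; first exact: lmul_continuous.
have [/nbhs_singleton /differentiableP d _] := mul_chart_diff (erefl (a * x)%g).
have [] := is_diff_comp (is_diff_pairr (chart a a) (chart x x)) d.
by rewrite /comp /mul_chart /= chart_inv_center.
Qed.

Lemma rmul_diff_at a x : diff_at (fun y : G => y * a)%g x.
Proof.
split; first exact: rmul_continuous.
have [/nbhs_singleton /differentiableP d _] := mul_chart_diff (erefl (x * a)%g).
have [] := is_diff_comp (is_diff_pairl (chart x x) (chart a a)) d.
by rewrite /comp /mul_chart /= chart_inv_center.
Qed.

Lemma conj_diff_at a x : diff_at (fun y : G => a * y * a^-1)%g x.
Proof. by have [] := tangent_map_comp (lmul_diff_at a x) (rmul_diff_at a^-1%g (a * x)%g). Qed.

Lemma AdE x Z : Ad x Z =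
  tangent_map (fun y : G => y * x^-1)%g (x * 1)%g (tangent_map (fun y : G => x * y)%g 1%g Z).
Proof.
exact: (proj2 (tangent_map_comp (lmul_diff_at x 1%g) (rmul_diff_at x^-1%g (x * 1)%g))).
Qed.

Lemma tangent_map_at (y z : G) (f : G -> G) v : y = z ->
  tangent_map f y v = tangent_map f z v.
Proof. by move->. Qed.

Lemma AdM x y Z : Ad (x * y)%g Z = Ad x (Ad y Z).
Proof.
have y1 : (y * 1 * y^-1 = 1)%g by rewrite mulg1 mulgV.
have [_ E] := tangent_map_comp (conj_diff_at y 1%g) (conj_diff_at x (y * 1 * y^-1)%g).
have E' := E Z; rewrite (tangent_map_at _ _ y1) in E'.
rewrite /Ad -{}E'; set f := (fun _ => _); set h := (_ \o _).
suff -> : f = h by [].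
by apply/funext => z; rewrite /f /h /= invgM !mulgA.
Qed.

Lemma Ad1 Z : Ad (1%g : G) Z = Z.
Proof.
rewrite /Ad; set f := (fun _ => _).
have -> : f = (fun y => y) by apply/funext => z; rewrite /f mul1g invg1 mulg1.
exact: tangent_map_id.
Qed.

Lemma AdK x : cancel (Ad x) (Ad x^-1%g).
Proof. by move=> Z; rewrite -AdM mulVg Ad1. Qed.

Lemma AdKV x : cancel (Ad x^-1%g) (Ad x).
Proof. by move=> Z; rewrite -AdM mulgV Ad1. Qed.

Lemma Ad_linear x : linear (Ad x).
Proof. by move=> a u v; rewrite /Ad /tangent_map linearP. Qed.

(** [Ad x] is the differential of a left translation followed by that of a right translation, and
    each preserves the metric. *)
Lemma bi_invariant_Ad (g : riemannian_metric G) : bi_invariant g ->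
  forall x u v, g 1%g (Ad x u) (Ad x v) = g 1%g u v.
Proof.
move=> gi x u v.
have x1 : (x * 1 * x^-1 = 1)%g by rewrite mulg1 mulgV.
rewrite -{1}x1 !AdE.
have [_ ->] := gi x^-1%g (x * 1)%g (tangent_map (fun y : G => x * y)%g 1%g u)
  (tangent_map (fun y : G => x * y)%g 1%g v).
by have [-> _] := gi x 1%g u v.
Qed.

End Translations.

(** * The bracket in charts *)

(* Without this, unification between differentials unfolds them and diverges. *)
Local Opaque diff.

Lemma near_pair_curry (S T : topologicalType) (P : S * T -> Prop) (a : S) (b : T) :
  (\forall z \near (a, b), P z) -> \forall r \near a, \forall q \near b, P (r, q).
Proof.
move=> [[A B] /= [Aa Bb] AB]; apply: filterS Aa => r Ar.
by apply: filterS Bb => q Bq; exact: AB.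
Qed.

Lemma linear_pair (K : pzRingType) (U V W : lmodType K) (D : {linear (U * V)%type -> W}) a b :
  D (a, b) = D (a, 0) + D (0, b).
Proof. by rewrite -linearD; congr (D _); congr pair; rewrite ?addr0 ?add0r. Qed.

Lemma linear_pairN (K : pzRingType) (U V W : lmodType K) (D : {linear (U * V)%type -> W}) b :
  D (0, - b) = - D (0, b).
Proof. by rewrite -linearN; congr (D _); congr pair; rewrite oppr0. Qed.

Section Bracket.
Context {R : realType} {n : nat} (G : lieGroupType R n).
Implicit Types (w x y : G) (a b v Z : 'rV[R]_n).

Definition inv_chart y x (q : 'rV[R]_n) : 'rV[R]_n := chart y (chart_inv x q)^-1%g.

Lemma inv_chart_diff y x : (x^-1)%g = y -> differentiable (inv_chart y x) (chart x x).
Proof. by move=> <-; have /smooth_near_diff[/nbhs_singleton] := invg_smooth x. Qed.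

Lemma inv_chart_center y x : (x^-1)%g = y -> inv_chart y x (chart x x) = chart y y.
Proof. by move=> xy; rewrite /inv_chart chart_inv_center xy. Qed.

Lemma inv_chart_near y x : (x^-1)%g = y -> \forall q \near chart x x,
  chart_inv y (inv_chart y x q) = (chart_inv x q)^-1%g.
Proof.
move=> xy; apply: (@chartK_near _ _ G _ (fun q => (chart_inv x q)^-1)%g).
  apply: (@continuous_comp _ _ _ (chart_inv x) (fun y : G => y^-1)%g).
    exact: chart_inv_continuous_center.
  exact: invg_continuous.
by rewrite chart_inv_center.
Qed.

Lemma mul_chart_center w x y : (x * y)%g = w ->
  mul_chart w x y (chart x x, chart y y) = chart w w.
Proof. by move=> xyw; rewrite /mul_chart /= !chart_inv_center xyw. Qed.

Lemma mul_chart_near w x y : (x * y)%g = w ->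
  \forall z \near (chart x x, chart y y),
    chart_inv w (mul_chart w x y z) = (chart_inv x z.1 * chart_inv y z.2)%g.
Proof.
move=> xyw; rewrite -xyw.
apply: (@chartK_near _ _ G _ (fun z : 'rV[R]_n * 'rV[R]_n => chart_inv x z.1 * chart_inv y z.2)%g).
  apply: (@continuous_comp _ _ _
      (fun z : 'rV[R]_n * 'rV[R]_n => (chart_inv x z.1, chart_inv y z.2))
      (fun p : G * G => p.1 * p.2)%g); last exact: mulg_continuous.
  apply: cvg_pair.
    apply: (@continuous_comp _ _ _ fst (chart_inv x)); first exact: cvg_fst.
    exact: chart_inv_continuous_center.
  apply: (@continuous_comp _ _ _ snd (chart_inv y)); first exact: cvg_snd.
  exact: chart_inv_continuous_center.
by rewrite /= !chart_inv_center.
Qed.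

Local Notation e0 := (chart (1%g : G) (1%g : G)).
Local Notation mul1 := (mul_chart (1%g : G) 1%g 1%g).

Local Notation inv1 := (inv_chart (1%g : G) 1%g).

(** The bilinear term of the Taylor expansion of the product at the identity, [a] varying the first
    factor and [b] the second. Its antisymmetrization will be the bracket. *)
Definition mixed a b : 'rV[R]_n :=
  'd (fun z => 'd mul1 z (0, b)) (e0, e0) (a, 0).

Lemma mulg11 : (1 * 1 = 1 :> G)%g. Proof. exact: mulg1. Qed.

Lemma mul1_e0r : \forall q \near e0, mul1 (q, e0) = q.
Proof.
have := chart_inv_near (1%g : G); apply: filterS => q E.
by rewrite /mul_chart /= chart_inv_center mulg1.
Qed.

Lemma mul1_e0l : \forall q \near e0, mul1 (e0, q) = q.
Proof.
have := chart_inv_near (1%g : G); apply: filterS => q E.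
by rewrite /mul_chart /= chart_inv_center mul1g.
Qed.

Lemma near_pairl (S T : topologicalType) (P : S * T -> Prop) (a : S) (b : T) :
  (\forall z \near (a, b), P z) -> \forall r \near a, P (r, b).
Proof.
by move=> /near_pair_curry; apply: filterS => r /nbhs_singleton.
Qed.

Lemma near_pairr (S T : topologicalType) (P : S * T -> Prop) (a : S) (b : T) :
  (\forall z \near (a, b), P z) -> \forall r \near b, P (a, r).
Proof.
by move=> /near_pair_curry /nbhs_singleton.
Qed.

(** Multiplication by the identity is the identity in coordinates. The equality is needed on a
    neighbourhood, because [second_mul1_ll] differentiates it once more. *)
Lemma diff_mul1l : \forall r \near e0, forall v, 'd mul1 (r, e0) (v, 0) = v.
Proof.
have [D _] := mul_chart_diff mulg11.
have J : \forall r \near e0, \forall q \near r, mul1 (q, e0) = q.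
  exact: (near_join mul1_e0r).
near=> r => v.
have Dr : is_diff (r, e0) mul1 ('d mul1 (r, e0)).
  by apply: differentiableP; near: r; exact: (near_pairl D).
have E' : \forall q \near r, id q = (mul1 \o (fun q => (q, e0))) q.
  have : \forall q \near r, mul1 (q, e0) = q by near: r.
  by apply: filterS => q /= ->.
exact: (is_diff_unique E' (is_diff_id r) (is_diff_comp (is_diff_pairl r e0) Dr) v).
Unshelve. all: by end_near. Qed.

Lemma diff_mul1r v : 'd mul1 (e0, e0) (0, v) = v.
Proof.
have [/nbhs_singleton D _] := mul_chart_diff mulg11.
have E' : \forall q \near e0, id q = (mul1 \o (fun q => (e0, q))) q.
  by have := mul1_e0l; apply: filterS => q /= ->.
exact: (is_diff_unique E' (is_diff_id e0)
  (is_diff_comp (is_diff_pairr e0 e0) (differentiableP D)) v).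
Qed.

Lemma mulVg_eq x y : (x^-1)%g = y -> (y * x = 1)%g.
Proof. by move=> <-; rewrite mulVg. Qed.

Lemma is_diff_inv_pair x y : (x^-1)%g = y ->
  is_diff (chart x x) (fun q => (inv_chart y x q, q))
    (fun a => ('d (inv_chart y x) (chart x x) a, a)).
Proof.
by move=> xy; exact: (is_diff_pair (differentiableP (inv_chart_diff xy)) (is_diff_id _)).
Qed.

Lemma diff_mulV x y : (x^-1)%g = y -> forall a,
  'd (mul_chart 1%g y x) (chart y y, chart x x) ('d (inv_chart y x) (chart x x) a, a) = 0.
Proof.
move=> xy a.
have [/nbhs_singleton/differentiableP D _] := mul_chart_diff (mulVg_eq xy).
have c0 : (inv_chart y x (chart x x), chart x x) = (chart y y, chart x x).
  by rewrite inv_chart_center.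
have E' : \forall q \near chart x x,
    e0 = (mul_chart 1%g y x \o (fun q => (inv_chart y x q, q))) q.
  by have := inv_chart_near xy; apply: filterS => q /= Eq; rewrite /mul_chart /= Eq mulVg.
exact: (is_diff_unique E' (is_diff_zero e0 _)
  (is_diff_comp_at (is_diff_inv_pair xy) D c0) a).
Qed.

Lemma diff_inv1 a : 'd (inv_chart (1%g : G) 1%g) e0 a = - a.
Proof.
have := diff_mulV (invg1 G) a; set b := 'd _ _ a.
rewrite linear_pair diff_mul1r (nbhs_singleton diff_mul1l) => /eqP.
by rewrite addr_eq0 => /eqP.
Qed.

Lemma second_mul_sym w x y : (x * y)%g = w -> forall u v : 'rV[R]_n * 'rV[R]_n,
  'd (fun z => 'd (mul_chart w x y) z v) (chart x x, chart y y) u =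
  'd (fun z => 'd (mul_chart w x y) z u) (chart x x, chart y y) v.
Proof.
by move=> xyw u v; have [D1 D2] := mul_chart_diff xyw; exact: second_diff_sym.
Qed.

Lemma second_mul1_ll a b : 'd (fun z => 'd mul1 z (b, 0)) (e0, e0) (a, 0) = 0.
Proof.
have [_ /(_ (b, 0))/differentiableP D2] := mul_chart_diff mulg11.
have E' : \forall q \near e0, b = ((fun z => 'd mul1 z (b, 0)) \o (fun q => (q, e0))) q.
  by have := diff_mul1l; apply: filterS => q /= ->.
exact: (is_diff_unique E' (is_diff_zero b e0)
  (is_diff_comp (is_diff_pairl e0 e0) D2) a).
Qed.


Lemma is_diff_pair_inv1 :
  is_diff e0 (fun r => (r, inv_chart (1%g : G) 1%g r)) (fun a => (a, - a)).
Proof.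
have := is_diff_pair (is_diff_id e0) (differentiableP (inv_chart_diff (invg1 G))).
by congr is_diff_def; apply/funext => a; rewrite diff_inv1.
Qed.

(** Conjugation reads [mul1 (mul1 (r, q), inv1 r)] in the chart at the identity. The chain rule at
    [q = e0] writes [Ad] through partial differentials of [mul1], a form that can be differentiated
    in [r]. *)
Lemma AdE_near Z : \forall r \near e0, Ad (chart_inv (1%g : G) r) Z =
  'd mul1 (r, inv1 r) ('d mul1 (r, e0) (0, Z), 0).
Proof.
have [D _] := mul_chart_diff mulg11.
have ic : {for e0, continuous (fun r => (r, inv1 r))}.
  by apply: differentiable_continuous; case: is_diff_pair_inv1.
have D' : \forall r \near e0, differentiable mul1 (r, inv1 r).
  have D0 : \forall z \near (e0, inv1 e0), differentiable mul1 z.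
    by rewrite (inv_chart_center (invg1 G)).
  exact: (ic _ D0).
near=> r.
have d1 : is_diff (r, e0) mul1 ('d mul1 (r, e0)).
  by apply: differentiableP; near: r; exact: (near_pairl D).
have m1 : mul1 (r, e0) = r by near: r; exact: mul1_e0r.
have d2 : is_diff (r, inv1 r) mul1 ('d mul1 (r, inv1 r)) by apply: differentiableP; near: r.
have c1 := is_diff_comp (is_diff_pairr r e0) d1.
have c2 := is_diff_comp_at (is_diff_comp_at c1 (is_diff_pairl r (inv1 r)) m1) d2
  (congr1 (pair^~ (inv1 r)) m1).
have E : \forall q \near e0, mul1 (mul1 (r, q), inv1 r) =
   chart (1%g : G) (chart_inv 1%g r * chart_inv 1%g q * (chart_inv 1%g r)^-1)%g.
  have Ei : chart_inv (1%g : G) (inv1 r) = (chart_inv 1%g r)^-1%g.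
    by near: r; exact: (inv_chart_near (invg1 G)).
  have : \forall q \near e0, chart_inv (1%g : G) (mul1 (r, q)) =
      (chart_inv 1%g r * chart_inv 1%g q)%g.
    by near: r; exact: (near_pair_curry (mul_chart_near mulg11)).
  by apply: filterS => q Eq; rewrite {1}/mul_chart /= Eq Ei.
have [_ E2] := near_eq_is_diff E c2.
rewrite /Ad /tangent_map mulg1 mulgV.
by rewrite E2.
Unshelve. all: by end_near. Qed.

(** In [AdE_near] the inner differential contributes [mixed a Z]. The outer base point [(r, inv1 r)]
    moves by [(a, - a)]: its first component contributes a pure second derivative, which is zero,
    and its second contributes [- mixed Z a] by symmetry of second derivatives. *)
Lemma is_diff_Ad1 Z :
  is_diff e0 (fun r => Ad (chart_inv (1%g : G) r) Z) (fun a => mixed a Z - mixed Z a).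
Proof.
have [/nbhs_singleton D D2] := mul_chart_diff mulg11.
have E : \forall r \near e0, 'd mul1 (r, inv_chart (1%g : G) 1%g r) ('d mul1 (r, e0) (0, Z), 0)
   = Ad (chart_inv (1%g : G) r) Z.
  by have := AdE_near Z; apply: filterS => r ->.
apply: near_eq_is_diff E _.
pose B r (u : 'rV[R]_n) := 'd mul1 (r, inv_chart (1%g : G) 1%g r) (u, 0).
have lB r : linear (B r).
  move=> k u v; rewrite /B -linearP; congr ('d _ _ _).
  by congr pair; rewrite /= scaler0 addr0.
have ip := is_diff_pair_inv1.
have dB u : is_diff e0 (B ^~ u)
    (fun a => 'd (fun z => 'd mul1 z (u, 0)) (e0, e0) (a, - a)).
  apply: (is_diff_comp_at ip (differentiableP (D2 (u, 0)))).
  by rewrite inv_chart_center //; exact: invg1.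
have du : is_diff e0 (fun r => 'd mul1 (r, e0) (0, Z)) (mixed ^~ Z).
  exact: (is_diff_comp (is_diff_pairl e0 e0) (differentiableP (D2 (0, Z)))).
have := is_diff_apply lB dB du (diff_mul1r Z).
congr is_diff_def; apply/funext => a.
have -> : B e0 (mixed a Z) = mixed a Z.
  rewrite /B inv_chart_center; last exact: invg1.
  exact: (nbhs_singleton diff_mul1l).
have S : _ = mixed Z a := second_mul_sym mulg11 (0, a) (Z, 0).
have L := second_mul1_ll a Z; move: S L.
move: ('d (fun z => 'd mul1 z (Z, 0)) (e0, e0)) => F S L.
by rewrite (linear_pair F) (linear_pairN F) L S add0r addrC.
Qed.

Lemma adE a Z : ad G a Z = mixed a Z - mixed Z a.
Proof. by rewrite /ad (diff_eqf _ (is_diff_Ad1 Z)). Qed.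

Lemma ad_anti a Z : ad G a Z = - ad G Z a.
Proof. by rewrite !adE opprB. Qed.

Lemma is_diff_Ad_one Z :
  is_diff e0 (fun r => Ad (chart_inv (1%g : G) r) Z) (fun a => ad G a Z).
Proof. by apply: differentiableP; case: (is_diff_Ad1 Z). Qed.

Lemma ad_linearl Z : linear (fun a => ad G a Z).
Proof. by move=> k u v; rewrite /ad linearP. Qed.

Lemma ad_linearr a : linear (ad G a).
Proof.
move=> k u v; rewrite !(ad_anti a) ad_linearl.
by rewrite opprD scalerN.
Qed.

End Bracket.

(** * The Maurer-Cartan equation *)

Section MaurerCartan.
Context {R : realType} {n : nat} (G : lieGroupType R n).
Implicit Types (w x y : G) (a b v Z : 'rV[R]_n).

Local Notation e0 := (chart (1%g : G) (1%g : G)).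
Local Notation mul1 := (mul_chart (1%g : G) 1%g 1%g).

(** The point of coordinates [q] and its tangent vectors are all read in the one chart at [x], so
    that the form can be differentiated in [q]; [left_triv] is its value at the centre. *)
Definition maurer_cartan x q v : 'rV[R]_n :=
  'd (fun q' => chart (1%g : G) ((chart_inv x q)^-1 * chart_inv x q')%g : 'rV[R]_n) q v.

Definition left_triv x v : 'rV[R]_n := maurer_cartan x (chart x x) v.

Lemma mul_chartE w x y a b :
  mul_chart w x y (a, b) = chart w (chart_inv x a * chart_inv y b)%g.
Proof. by []. Qed.

Section AtPoint.
Variable x : G.
Local Notation y := (x^-1)%g.
Local Notation mu := (mul_chart 1%g y x).
Local Notation r0 := (chart y y).
Local Notation q0 := (chart x x).
Local Notation iota := (inv_chart y x).

Lemma maurer_cartan_linear q : linear (maurer_cartan x q).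
Proof. by move=> k u v; rewrite /maurer_cartan linearP. Qed.

Lemma inv_pair_center : (iota q0, q0) = (r0, q0).
Proof. by rewrite inv_chart_center. Qed.

(** Exhibits the form as a partial differential of the chart product around [(x^-1, x)], whose
    second derivatives are under control. *)
Lemma maurer_cartan_near : \forall q \near q0, forall v,
  maurer_cartan x q v = 'd mu (iota q, q) (0, v).
Proof.
have [D _] := mul_chart_diff (mulVg x).
have ic : {for q0, continuous (fun q => (iota q, q))}.
  by apply: differentiable_continuous; case: (is_diff_inv_pair (erefl y)).
have D' : \forall q \near q0, differentiable mu (iota q, q).
  have D0 : \forall z \near (iota q0, q0), differentiable mu z.
    by rewrite inv_pair_center.
  exact: (ic _ D0).
near=> q => v.
have Dq : is_diff (iota q, q) mu ('d mu (iota q, q)).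
  by apply: differentiableP; near: q.
have E : chart_inv y (iota q) = ((chart_inv x q)^-1)%g.
  by near: q; exact: (inv_chart_near (erefl y)).
rewrite /maurer_cartan.
have := diff_eqf v (is_diff_comp (is_diff_pairr (iota q) q) Dq).
by rewrite /comp {1}/mul_chart /= E.
Unshelve. all: by end_near. Qed.

Lemma left_trivE v : left_triv x v = 'd mu (r0, q0) (0, v).
Proof.
by rewrite /left_triv (nbhs_singleton maurer_cartan_near) inv_pair_center.
Qed.

Lemma is_diff_maurer_cartan v : is_diff q0 (fun q => maurer_cartan x q v)
  (fun a => 'd (fun z => 'd mu z (0, v)) (r0, q0) ('d iota q0 a, a)).
Proof.
have [_ /(_ (0, v))/differentiableP D2] := mul_chart_diff (mulVg x).
have E : \forall q \near q0, 'd mu (iota q, q) (0, v) = maurer_cartan x q v.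
  by have := maurer_cartan_near; apply: filterS => q ->.
apply: near_eq_is_diff E _.
exact: (is_diff_comp_at (is_diff_inv_pair (erefl y)) D2 inv_pair_center).
Qed.

Lemma is_diff_lmul_chart : is_diff q0 (fun q => mu (r0, q)) (left_triv x).
Proof.
have [/nbhs_singleton/differentiableP D _] := mul_chart_diff (mulVg x).
have := is_diff_comp (is_diff_pairr r0 q0) D.
by congr is_diff_def; apply/funext => v; rewrite left_trivE.
Qed.

(** For [r] near [x^-1] and [q] near [x], [r * q = (r * x) * (x^-1 * q)]; in charts, [mu (r, q) =
    mul1 (mu (r, q0), mu (r0, q))]. Differentiating in [q], then in [r], carries the mixed
    derivative at [(x^-1, x)] to the identity. *)
Lemma second_mul_mixed c b :
  'd (fun z => 'd mu z (0, b)) (r0, q0) (c, 0) =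
  mixed G ('d mu (r0, q0) (c, 0)) (left_triv x b).
Proof.
have [D D2] := mul_chart_diff (mulVg x).
have [D1 D12] := mul_chart_diff (@mulg11 _ _ G).
have mc := mul_chart_center (mulVg x).
have dpsi : is_diff r0 (fun r => mu (r, q0)) (fun c => 'd mu (r0, q0) (c, 0)).
  exact: (is_diff_comp (is_diff_pairl r0 q0) (differentiableP (nbhs_singleton D))).
have dpsi2 : is_diff r0 (fun r => (mu (r, q0), e0)) (fun c => ('d mu (r0, q0) (c, 0), 0)).
  exact: (is_diff_pair dpsi (is_diff_zero e0 r0)).
have Dpsi : \forall r \near r0, differentiable mul1 (mu (r, q0), e0).
  have pc : {for r0, continuous (fun r => (mu (r, q0), e0))}.
    by apply: differentiable_continuous; case: dpsi2.
  have D0 : \forall z \near (mu (r0, q0), e0), differentiable mul1 z by rewrite mc.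
  exact: (pc _ D0).
have E2 : \forall r \near r0,
    'd mul1 (mu (r, q0), e0) (0, left_triv x b) = 'd mu (r, q0) (0, b).
  have Dr := near_pairl D.
  have M1 := near_pairl (mul_chart_near (mulVg x)).
  have M2 := near_pairr (mul_chart_near (mulVg x)).
  near=> r.
  have H1 : is_diff (mu (r, q0), e0) mul1 ('d mul1 (mu (r, q0), e0)).
    by apply: differentiableP; near: r.
  have H2 : is_diff (r, q0) mu ('d mu (r, q0)) by apply: differentiableP; near: r.
  have c1 := is_diff_comp_at is_diff_lmul_chart (is_diff_pairr (mu (r, q0)) e0) mc.
  have c2 := is_diff_comp_at c1 H1 (congr1 (pair (mu (r, q0))) mc).
  have c3 := is_diff_comp (is_diff_pairr r q0) H2.
  have m1 : chart_inv (1%g : G) (mu (r, q0)) = (chart_inv y r * chart_inv x q0)%g.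
    by near: r.
  have E : \forall q \near q0, (mu \o (fun q => (r, q))) q =
      (mul1 \o ((fun q => (mu (r, q0), q)) \o (fun q => mu (r0, q)))) q.
    apply: filterS M2 => q /= m2.
    rewrite [RHS]mul_chartE m1 m2 /= !chart_inv_center mul_chartE.
    by rewrite mulgA mulgK.
  exact: (is_diff_unique E c3 c2 b).
have dL := is_diff_comp (is_diff_pairl r0 q0) (differentiableP (D2 (0, b))).
have dR := is_diff_comp_at dpsi2 (differentiableP (D12 (0, left_triv x b)))
  (congr1 (pair^~ e0) mc).
exact: (is_diff_unique E2 dR dL c).
Unshelve. all: by end_near. Qed.

Lemma diff_mul_iota a : 'd mu (r0, q0) ('d iota q0 a, 0) = - left_triv x a.
Proof.
have := diff_mulV (erefl y) a; rewrite left_trivE.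
move: ('d mu (r0, q0)) => F; rewrite (linear_pair F) => /eqP.
by rewrite addr_eq0 => /eqP.
Qed.

Lemma mixedNl u v : mixed G (- u) v = - mixed G u v.
Proof.
rewrite /mixed; move: ('d _ (e0, e0)) => F.
by rewrite -(linearN F); congr (F _); congr pair; rewrite oppr0.
Qed.

Lemma second_mul_iota a b :
  'd (fun z => 'd mu z (0, b)) (r0, q0) ('d iota q0 a, 0) =
  - mixed G (left_triv x a) (left_triv x b).
Proof.
apply: etrans (second_mul_mixed _ _) _.
by rewrite diff_mul_iota mixedNl.
Qed.

(** Each derivative splits into a pure second derivative in the factor [x] and a part coming from
    the motion of the inverse. The pure parts agree by symmetry and cancel; the others are the two
    [mixed] terms of the bracket. *)
Lemma maurer_cartan_eq a b :
  'd (fun q => maurer_cartan x q b) q0 a - 'd (fun q => maurer_cartan x q a) q0 b =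
  - ad G (left_triv x a) (left_triv x b).
Proof.
apply: etrans (congr2 (fun u v => u - v) (diff_eqf a (is_diff_maurer_cartan b))
  (diff_eqf b (is_diff_maurer_cartan a))) _.
have S := second_mul_sym (mulVg x) (0, a) (0, b).
have Ha := second_mul_iota a b.
have Hb := second_mul_iota b a.
rewrite adE; move: S Ha Hb.
move: ('d (fun z => 'd mu z (0, b)) (r0, q0)) => F.
move: ('d (fun z => 'd mu z (0, a)) (r0, q0)) => F'.
move=> S Ha Hb.
rewrite (linear_pair F) (linear_pair F') Ha Hb S.
by rewrite opprD addrACA subrr addr0 opprK opprB addrC.
Qed.

(** Writing [q = x * (x^-1 * q)] gives [Ad q = Ad x (Ad (x^-1 * q))], which reduces the claim to the
    derivative at the identity. *)
Lemma is_diff_Ad Z : is_diff q0 (fun q => Ad (chart_inv x q) Z)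
  (fun a => Ad x (ad G (left_triv x a) Z)).
Proof.
have c1 := is_diff_comp_at is_diff_lmul_chart (is_diff_Ad_one G Z) (mul_chart_center (mulVg x)).
have c2 := is_diff_comp_at c1 (is_diff_linear_mx _ (Ad_linear x)) erefl.
apply: near_eq_is_diff c2.
have := near_pairr (mul_chart_near (mulVg x)); apply: filterS => q /= E.
by rewrite E chart_inv_center AdM AdKV.
Qed.

Lemma left_triv_tangent v : left_triv x v = tangent_map (fun z : G => y * z)%g x v.
Proof. by rewrite /left_triv /maurer_cartan /tangent_map mulVg chart_inv_center. Qed.

Lemma left_triv_surj Z : exists v, left_triv x v = Z.
Proof.
exists (tangent_map (fun z : G => x * z)%g 1%g Z).
rewrite left_triv_tangent -(tangent_map_at _ _ (mulg1 x)).
have [_ E] := tangent_map_comp (lmul_diff_at x 1%g) (lmul_diff_at y (x * 1)%g).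
rewrite -E; set f := (_ \o _).
have -> : f = (fun z => z) by apply/funext => z; rewrite /f /= mulKg.
exact: tangent_map_id.
Qed.

(** Tangent vectors at a nearby point are read in that point's own chart, whereas canonical
    coordinates use [chart x]. The change of chart in [chart_vector] is absorbed by the chain rule,
    which brings the Maurer-Cartan form into the canonical momentum. *)
Lemma tangent_chart_vector : \forall q \near q0, forall v,
  tangent_map (fun z : G => (chart_inv x q)^-1 * z)%g (chart_inv x q) (chart_vector x q v)
  = maurer_cartan x q v.
Proof.
apply: filterS (chart_img_near x) => q xq v.
have [z xz zq] := xq.
have qz : chart_inv x q = z by rewrite -zq chartK.
have dt : differentiable (fun q' => chart z (chart_inv x q') : 'rV[R]_n) q.
  have [D _] := chart_transition_smooth x z 1%N.
  by apply: D; exists z => //; split=> //; exact: chart_dom_center.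
have [_ dl] := lmul_diff_at z^-1%g z.
rewrite /chart_vector /maurer_cartan /tangent_map qz.
have c := is_diff_comp_at (differentiableP dt) (differentiableP dl) (congr1 (chart z) qz).
rewrite mulVg in c *.
have E : \forall q' \near q, ((fun r => chart (1%g : G) (z^-1 * chart_inv z r)%g : 'rV[R]_n)
    \o (fun q' => chart z (chart_inv x q') : 'rV[R]_n)) q' =
    chart (1%g : G) (z^-1 * chart_inv x q')%g.
  have := @chartK_near _ _ G _ (chart_inv x) q z (chart_inv_continuous _ _ xq) qz.
  by apply: filterS => q' /= ->.
exact: (esym (diff_eqf v (near_eq_is_diff E c))).
Qed.

End AtPoint.
End MaurerCartan.

(** * Coadjoint action and momentum map *)

Section Covectors.
Context {R : realType} {n : nat}.
Implicit Types (Y v : 'rV[R]_n) (xi : 'cV[R]_n).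

Lemma dpairDl xi xi' Y : dpair (xi + xi') Y = dpair xi Y + dpair xi' Y.
Proof. by rewrite /dpair mulmxDr mxE. Qed.

Lemma dpairZl k xi Y : dpair (k *: xi) Y = k * dpair xi Y.
Proof. by rewrite /dpair -scalemxAr mxE. Qed.

Lemma dpairDr xi Y Y' : dpair xi (Y + Y') = dpair xi Y + dpair xi Y'.
Proof. by rewrite /dpair mulmxDl mxE. Qed.

Lemma dpairZr k xi Y : dpair xi (k *: Y) = k * dpair xi Y.
Proof. by rewrite /dpair -scalemxAl mxE. Qed.

Lemma dpairNl xi Y : dpair (- xi) Y = - dpair xi Y.
Proof. by rewrite -scaleN1r dpairZl mulN1r. Qed.

Lemma dpairNr xi Y : dpair xi (- Y) = - dpair xi Y.
Proof. by rewrite -scaleN1r dpairZr mulN1r. Qed.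

Lemma dpair0l Y : dpair (0 : 'cV[R]_n) Y = 0.
Proof. by rewrite /dpair mulmx0 mxE. Qed.

Lemma dpair0r xi : dpair xi 0 = 0.
Proof. by rewrite /dpair mul0mx mxE. Qed.

Lemma dpair_linearl Y : linear (fun xi => dpair xi Y : R^o).
Proof. by move=> k u v; rewrite dpairDl dpairZl. Qed.

Lemma dpair_linearr xi : linear (fun Y => dpair xi Y : R^o).
Proof. by move=> k u v; rewrite dpairDr dpairZr. Qed.

Lemma dpair_delta xi i : dpair xi (delta_mx 0 i) = xi i 0.
Proof. by rewrite /dpair -rowE mxE. Qed.

Lemma covectorK (f : 'rV[R]_n -> R) Y : linear (f : _ -> R^o) -> dpair (covector f) Y = f Y.
Proof.
move=> lf; rewrite (linear_sum_delta lf) big_ord1 /dpair mxE.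
by apply: eq_bigr => j _; rewrite mxE.
Qed.

Lemma dpair_inj xi xi' : (forall Y, dpair xi Y = dpair xi' Y) -> xi = xi'.
Proof. by move=> E; apply/colP => i; rewrite -!dpair_delta. Qed.

Lemma is_diff_dpair (V : normedModType R) (f df : V -> 'cV[R]_n) x :
  (forall Y, is_diff x (fun y => dpair (f y) Y : R^o) (fun t => dpair (df t) Y)) ->
  is_diff x f df.
Proof.
move=> H; apply: is_diff_mx => i j; have := H (delta_mx 0 i).
by rewrite ord1; congr is_diff_def; apply/funext => v; rewrite dpair_delta.
Qed.

End Covectors.

Section Coadjoint.
Context {R : realType} {n : nat} (G : lieGroupType R n).
Implicit Types (x y : G) (Y Z v : 'rV[R]_n) (xi eta : 'cV[R]_n).

Lemma dpair_coAd x xi Y : dpair (coAd x xi) Y = dpair xi (Ad x Y).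
Proof. by rewrite covectorK // => k u v; rewrite Ad_linear dpair_linearr. Qed.

Lemma dpair_coad Y xi Z : dpair (coad G Y xi) Z = dpair xi (ad G Y Z).
Proof. by rewrite covectorK // => k u v; rewrite ad_linearr dpair_linearr. Qed.

Lemma coAd_linear x : linear (coAd x).
Proof.
move=> k u v; apply: dpair_inj => Y.
by rewrite dpairDl dpairZl !dpair_coAd dpairDl dpairZl.
Qed.

Lemma coad_linearr Y : linear (coad G Y).
Proof.
move=> k u v; apply: dpair_inj => Z.
by rewrite dpairDl dpairZl !dpair_coad dpairDl dpairZl.
Qed.

Lemma coad_linearl xi : linear (fun Y => coad G Y xi).
Proof.
move=> k u v; apply: dpair_inj => Z.
by rewrite dpairDl dpairZl !dpair_coad ad_linearl dpairDr dpairZr.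
Qed.

Lemma coAdK x : cancel (coAd x) (coAd x^-1%g).
Proof. by move=> xi; apply: dpair_inj => Y; rewrite !dpair_coAd AdKV. Qed.

Lemma coAdKV x : cancel (coAd x^-1%g) (coAd x).
Proof. by move=> xi; apply: dpair_inj => Y; rewrite !dpair_coAd AdK. Qed.

Lemma is_diff_coAd x eta : is_diff (chart x x) (fun q => coAd (chart_inv x q) eta)
  (fun a => coad G (left_triv x a) (coAd x eta)).
Proof.
apply: is_diff_dpair => Y.
have := is_diff_comp_at (is_diff_Ad x Y) (is_diff_linear_mx _ (dpair_linearr eta)) erefl.
congr is_diff_def; apply/funext => a /=; first by rewrite dpair_coAd.
by rewrite dpair_coad dpair_coAd.
Qed.

Lemma coAd_inv_differentiable x eta :
  differentiable (fun q => coAd (chart_inv x q)^-1%g eta) (chart x x).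
Proof.
have [D _] := is_diff_comp_at (differentiableP (inv_chart_diff (erefl x^-1%g)))
  (is_diff_coAd x^-1%g eta) (inv_chart_center erefl).
have E : \forall q \near chart x x,
    ((fun q => coAd (chart_inv x^-1%g q) eta) \o inv_chart x^-1%g x) q =
    coAd (chart_inv x q)^-1%g eta.
  by have := inv_chart_near (erefl x^-1%g); apply: filterS => q /= ->.
by have [] := near_eq_is_diff E (differentiableP D).
Qed.

Local Notation T := (@bundle_tangent R n).

Lemma is_diff_tangent1 (z : T) : is_diff z (fun z : T => z.1.1.1) (fun w : T => w.1.1.1).
Proof.
have d1 := is_diff_fst z; have d2 := is_diff_fst z.1; have d3 := is_diff_fst z.1.1.
exact: (is_diff_comp_at (is_diff_comp_at d1 d2 erefl) d3 erefl).
Qed.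

Lemma is_diff_tangent2 (z : T) : is_diff z (fun z : T => z.1.1.2) (fun w : T => w.1.1.2).
Proof.
have d1 := is_diff_fst z; have d2 := is_diff_fst z.1; have d3 := is_diff_snd z.1.1.
exact: (is_diff_comp_at (is_diff_comp_at d1 d2 erefl) d3 erefl).
Qed.

Lemma is_diff_tangent3 (z : T) : is_diff z (fun z : T => z.1.2) (fun w : T => w.1.2).
Proof.
have d1 := is_diff_fst z; have d2 := is_diff_snd z.1.
exact: (is_diff_comp_at d1 d2 erefl).
Qed.

Lemma is_diff_coad (V : normedModType R) (f df : V -> 'rV[R]_n)
    (h dh : V -> 'cV[R]_n) z : is_diff z f df -> is_diff z h dh ->
  is_diff z (fun t => coad G (f t) (h t))
    (fun w => coad G (df w) (h z) + coad G (f z) (dh w)).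
Proof.
move=> df' dh'.
apply: (is_diff_apply (B := fun t M => coad G (f t) M)
  (dB := fun M w => coad G (df w) M)) => //.
- by move=> y; exact: coad_linearr.
- move=> N.
  exact: (is_diff_comp_at df' (is_diff_linear_mx _ (coad_linearl N)) erefl).
Qed.

(** The left-trivialized covector [T_e^* L_x alpha_x], recovered from [mu] by undoing the shift in
    rho. *)
Definition shifted (z : T) : 'cV[R]_n := z.1.2 - coad G z.1.1.2 z.2.

Lemma is_diff_shifted (z : T) : is_diff z shifted
  (fun w => w.1.2 - (coad G w.1.1.2 z.2 + coad G z.1.1.2 w.2)).
Proof.
exact: (is_diffB (is_diff_tangent3 z) (is_diff_coad (is_diff_tangent2 z) (is_diff_snd z))).
Qed.

Section AtPoint.
Variables (x : G) (Y : 'rV[R]_n) (mu xi : 'cV[R]_n).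
Let z0 : T := (chart x x, Y, mu, xi).
Let m0 : bundle G := (x, Y, mu, xi).

Lemma momentum_differentiable :
  differentiable (fun z : T => coAd (chart_inv x z.1.1.1)^-1%g (shifted z)) z0.
Proof.
have dB N : is_diff z0 (fun z : T => coAd (chart_inv x z.1.1.1)^-1%g N)
    (fun w => 'd (fun q => coAd (chart_inv x q)^-1%g N) (chart x x) w.1.1.1).
  exact: (is_diff_comp_at (is_diff_tangent1 z0)
    (differentiableP (coAd_inv_differentiable x N)) erefl).
have lB (z : T) : linear (coAd (chart_inv x z.1.1.1)^-1%g) by exact: coAd_linear.
by have [] := is_diff_apply lB dB (is_diff_shifted z0) erefl.
Qed.

(** Obtained by differentiating [coAd x (momentum m) = mu - coad Y xi]. The inverse in [momentum]
    then only has to be differentiable; its derivative is never computed. *)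
Lemma bundle_diff_momentum w :
  w.1.2 - (coad G w.1.1.2 xi + coad G Y w.2) =
  coad G (left_triv x w.1.1.1) (coAd x (momentum m0))
  + coAd x (bundle_diff (@momentum _ _ G) m0 w).
Proof.
have dB N : is_diff z0 (fun z : T => coAd (chart_inv x z.1.1.1) N)
    (fun w => coad G (left_triv x w.1.1.1) (coAd x N)).
  exact: (is_diff_comp_at (is_diff_tangent1 z0) (is_diff_coAd x N) erefl).
have lB (z : T) : linear (coAd (chart_inv x z.1.1.1)) by exact: coAd_linear.
have J0 : coAd (chart_inv x z0.1.1.1)^-1%g (shifted z0) = momentum m0.
  by rewrite /= chart_inv_center.
have D := is_diff_apply lB dB (differentiableP momentum_differentiable) J0.
have E : \forall z \near z0, coAd (chart_inv x z.1.1.1)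
    (coAd (chart_inv x z.1.1.1)^-1%g (shifted z)) = shifted z.
  by near=> z; exact: coAdKV.
have := is_diff_unique E D (is_diff_shifted z0) w.
by rewrite /= chart_inv_center.
Unshelve. all: by end_near. Qed.

Lemma bundle_diff_reduction eta w :
  bundle_diff (reduction eta : bundle G -> ambient) m0 w =
  (coad G (left_triv x w.1.1.1) (coAd x eta), w.1.1.2, w.2).
Proof.
have d1 := is_diff_comp_at (is_diff_tangent1 z0) (is_diff_coAd x eta) erefl.
have d := is_diff_pair (is_diff_pair d1 (is_diff_tangent2 z0)) (is_diff_snd z0).
exact: (diff_eqf w d).
Qed.

End AtPoint.
End Coadjoint.

(** * The reduced symplectic form *)

Section ReducedForm.
Context {R : realType} {n : nat} (G : lieGroupType R n).
Implicit Types (Y Z v : 'rV[R]_n) (xi eta : 'cV[R]_n).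

Local Notation T := (@bundle_tangent R n).

Lemma covector_ext (f h : 'rV[R]_n -> R) : f =1 h -> covector f = covector h.
Proof. by move=> fh; apply/colP => i; rewrite !mxE fh. Qed.

Definition chart_momentum (x : G) (z : T) : 'cV[R]_n :=
  covector (fun v => dpair (shifted G z) (maurer_cartan x z.1.1.1 v)).

Section AtPoint.
Variables (x : G) (Y : 'rV[R]_n) (mu xi : 'cV[R]_n).
Let z0 : T := (chart x x, Y, mu, xi).
Let m0 : bundle G := (x, Y, mu, xi).

Lemma canonical_coords_near : \forall z \near z0,
  canonical_coords x (rho_inv ((chart_inv x z.1.1.1, z.1.1.2, z.1.2, z.2) : bundle G)) =
  ((z.1.1.1, z.1.1.2), (chart_momentum x z, z.2)).
Proof.
have c1 : {for z0, continuous (fun z : T => z.1.1.1)}.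
  by apply: differentiable_continuous; case: (is_diff_tangent1 z0).
have N1 : \forall z \near z0, chart x (chart_inv x z.1.1.1) = z.1.1.1.
  exact: (c1 _ (chart_inv_near x)).
have N2 : \forall z \near z0, forall v,
    tangent_map (fun y : G => (chart_inv x z.1.1.1)^-1 * y)%g (chart_inv x z.1.1.1)
      (chart_vector x z.1.1.1 v) = maurer_cartan x z.1.1.1 v.
  exact: (c1 _ (tangent_chart_vector x)).
apply: filterS2 N1 N2 => -[[[q Y'] mu'] xi'] E1 E2.
rewrite /canonical_coords /rho_inv.
rewrite [chart x (chart_inv x _)]E1.
apply: (congr1 (fun P => ((q, Y'), (P, xi')))); apply: covector_ext => v.
rewrite covectorK; last by move=> k u u'; rewrite /tangent_map linearP dpair_linearr.
by congr (dpair _ _); exact: E2.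
Qed.

Definition chart_momentum_diff (w : T) v : R :=
  dpair (shifted G z0) ('d (fun q => maurer_cartan x q v) (chart x x) w.1.1.1) +
  dpair (w.1.2 - (coad G w.1.1.2 xi + coad G Y w.2)) (left_triv x v).

Lemma is_diff_pairing v :
  is_diff z0 (fun z : T => dpair (shifted G z) (maurer_cartan x z.1.1.1 v) : R^o)
    (fun w => chart_momentum_diff w v).
Proof.
have dB N : is_diff z0 (fun z : T => dpair N (maurer_cartan x z.1.1.1 v) : R^o)
    (fun w => dpair N ('d (fun q => maurer_cartan x q v) (chart x x) w.1.1.1)).
  have D : differentiable (fun q => maurer_cartan x q v) (chart x x).
    by case: (is_diff_maurer_cartan x v).
  have c := is_diff_comp_at (is_diff_tangent1 z0) (differentiableP D) erefl.
  exact: (is_diff_comp_at c (is_diff_linear_mx _ (dpair_linearr N)) erefl).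
have lB (z : T) : linear (fun N => dpair N (maurer_cartan x z.1.1.1 v) : R^o).
  exact: dpair_linearl.
exact: (is_diff_apply lB dB (is_diff_shifted G z0) erefl).
Qed.

Lemma is_diff_chart_momentum :
  is_diff z0 (chart_momentum x) (fun w => covector (chart_momentum_diff w)).
Proof.
apply: is_diff_mx => i j; have := is_diff_pairing (delta_mx 0 i).
by congr is_diff_def; apply/funext => z; rewrite mxE.
Qed.

(** Linearity in [v] is hidden under a derivative of [maurer_cartan]. Uniqueness of the differential
    supplies it: pairing with [v] before or after differentiating gives the same result. *)
Lemma dpair_chart_momentum_diff w v :
  dpair (covector (chart_momentum_diff w)) v = chart_momentum_diff w v.
Proof.
have d := is_diff_comp_at is_diff_chart_momentum (is_diff_linear_mx _ (dpair_linearl v)) erefl.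
have E : \forall z \near z0, dpair (shifted G z) (maurer_cartan x z.1.1.1 v) =
   ((fun N => dpair N v : R^o) \o chart_momentum x) z.
  near=> z; rewrite /= covectorK // => k u u'.
  by rewrite maurer_cartan_linear dpair_linearr.
exact: (is_diff_unique E (is_diff_pairing v) d w).
Unshelve. all: by end_near. Qed.

Lemma canonical_coords_diff w :
  bundle_diff (fun m' => canonical_coords x (rho_inv m') : coords) m0 w =
  ((w.1.1.1, w.1.1.2), (covector (chart_momentum_diff w), w.2)).
Proof.
have E : \forall z \near z0, ((z.1.1.1, z.1.1.2), (chart_momentum x z, z.2)) =
  canonical_coords x (rho_inv ((chart_inv x z.1.1.1, z.1.1.2, z.1.2, z.2) : bundle G)).
  by have := canonical_coords_near; apply: filterS => z ->.
have d := is_diff_pair (is_diff_pair (is_diff_tangent1 z0) (is_diff_tangent2 z0))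
  (is_diff_pair is_diff_chart_momentum (is_diff_snd z0)).
exact: (diff_eqf w (near_eq_is_diff E d)).
Qed.

(** On [ker dJ] the variation of [shifted] is [ad^*_Z theta], with [Z] the left-trivialized
    velocity. The product rule yields [theta([Z2, Z1]) - theta([Z1, Z2])]; the Maurer-Cartan
    equation cancels the first term. *)
Lemma Omega_momentum_ker eta w1 w2 : momentum m0 = eta ->
  bundle_diff (@momentum _ _ G) m0 w1 = 0 -> bundle_diff (@momentum _ _ G) m0 w2 = 0 ->
  Omega m0 w1 w2 =
  - dpair (coAd x eta) (ad G (left_triv x w1.1.1.1) (left_triv x w2.1.1.1))
  + dpair w2.2 w1.1.1.2 - dpair w1.2 w2.1.1.2.
Proof.
move=> m0eta k1 k2.
have nu0 : shifted G z0 = coAd x eta by rewrite -m0eta /= coAdKV.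
have coAd0 : coAd x 0 = 0 by apply: dpair_inj => Z; rewrite dpair_coAd !dpair0l.
have K w : bundle_diff (@momentum _ _ G) m0 w = 0 ->
    w.1.2 - (coad G w.1.1.2 xi + coad G Y w.2) = coad G (left_triv x w.1.1.1) (coAd x eta).
  by move=> k; rewrite (bundle_diff_momentum x Y mu xi w) k coAd0 addr0 m0eta.
rewrite /Omega !canonical_coords_diff /std_form /= !dpair_chart_momentum_diff.
rewrite /chart_momentum_diff !K // nu0 !dpair_coad.
have alg (D D' L L' : 'rV[R]_n) (th : 'cV[R]_n) (s t : R) : D - D' = - L' ->
    dpair th D + dpair th L' + s - (dpair th D' + dpair th L + t) = - dpair th L + s - t.
  by move=> /eqP; rewrite subr_eq => /eqP ->; rewrite dpairDr dpairNr; ring.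
exact: alg (maurer_cartan_eq x w2.1.1.1 w1.1.1.1).
Qed.

End AtPoint.

(** [Z], [U] and [zeta] can be prescribed freely: the [mu] component of the lift is then solved from
    [bundle_diff_momentum] with vanishing variation of the momentum. *)
Lemma lift_tangent (x : G) Y xi eta Z U zeta :
  let m : bundle G := (x, Y, coAd x eta + coad G Y xi, xi) in
  momentum m = eta /\ exists w : T,
  bundle_diff (@momentum _ _ G) m w = 0 /\
  bundle_diff (reduction eta : bundle G -> ambient) m w =
    (coad G Z (coAd x eta), U, zeta).
Proof.
move=> m; have meta : momentum m = eta by rewrite /= addrK coAdK.
split=> //; have [v vZ] := left_triv_surj x Z.
exists (v, U, coad G Z (coAd x eta) + (coad G U xi + coad G Y zeta), zeta).
split; last by rewrite bundle_diff_reduction /= vZ.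
apply: (can_inj (coAdK x)).
set w := (v, _, _, _).
have := bundle_diff_momentum x Y (coAd x eta + coad G Y xi) xi w.
rewrite -/m meta /= vZ addrK => /eqP.
rewrite -[X in X == _]addr0 (inj_eq (addrI _)) => /eqP <-.
by apply: dpair_inj => W; rewrite dpair_coAd !dpair0l.
Qed.

Lemma orbit_tangentP eta theta delta : orbit_tangent G eta theta delta ->
  exists Z, delta = coad G Z theta.
Proof.
move=> [x [v [<- ->]]]; exists (left_triv x v).
exact: (diff_eqf v (is_diff_coAd x eta)).
Qed.

Lemma coad_orbit_tangent (x : G) eta Z :
  orbit_tangent G eta (coAd x eta) (coad G Z (coAd x eta)).
Proof.
have [v <-] := left_triv_surj x Z; exists x, v; split=> //.
exact: (esym (diff_eqf v (is_diff_coAd x eta))).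
Qed.

Lemma dpair_coad_anti Z Z' theta :
  dpair (coad G Z theta) Z' = - dpair (coad G Z' theta) Z.
Proof. by rewrite !dpair_coad ad_anti dpairNr. Qed.

(** [lift_tangent] makes the set of candidate values nonempty, which excludes the default [0] of
    [xget]; [Omega_momentum_ker] then evaluates whichever lift was picked. *)
Lemma Omega_barE eta theta Y xi delta U zeta Z' U' zeta' :
  orbit G eta theta -> orbit_tangent G eta theta delta ->
  Omega_bar G eta (theta, Y, xi) (delta, U, zeta) (coad G Z' theta, U', zeta') =
  - dpair delta Z' + dpair zeta' U - dpair zeta U'.
Proof.
move=> [x _ xth] /orbit_tangentP[Z ->]; rewrite /Omega_bar; set S := [set r | _].
have : S (xget 0 S).
  apply: xgetPex.
  have [meta [w1 [k1 r1]]] := lift_tangent x Y xi eta Z U zeta.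
  have [_ [w2 [k2 r2]]] := lift_tangent x Y xi eta Z' U' zeta'.
  set m := (x, Y, coAd x eta + coad G Y xi, xi) in meta k1 r1 k2 r2.
  exists (Omega m w1 w2), m, w1, w2; rewrite -xth; split=> //.
move: (xget 0 S) => r.
move=> [[[[x' Y'] mu] xi'] [w1 [w2 [meta [th YY xixi] [k1 k2] []]]]].
rewrite !bundle_diff_reduction th => -[e1 <- <-] [e2 <- <-] ->.
rewrite (Omega_momentum_ker meta k1 k2) th; congr (_ + _ - _).
(* Antisymmetry brings each velocity in turn into the slot of [coad], where only its action on
   [theta] counts, and that action is prescribed by [e1] and [e2]. *)
rewrite -dpair_coad dpair_coad_anti e2 opprK.
by rewrite dpair_coad_anti e1.
Qed.

End ReducedForm.

(** * Metric and energy *)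

Lemma linear_lincomb (K : pzRingType) (V W : lmodType K) (L : V -> W) :
  linear L -> forall (I : finType) (k : I -> K) (F : I -> V),
  L (\sum_i k i *: F i) = \sum_i k i *: L (F i).
Proof.
move=> lL I k F; pose lc := GRing.isLinear.Build _ _ _ _ L lL.
pose D : {linear V -> W} := HB.pack L lc.
rewrite -[L]/(D : _ -> _) linear_sum.
by apply: eq_bigr => i _; rewrite linearZ.
Qed.

Section Metric.
Context {R : realType} {n : nat} (G : lieGroupType R n) (g : riemannian_metric G).
Implicit Types (X Y Z v : 'rV[R]_n) (xi eta : 'cV[R]_n).

Lemma metric_linearr (x : G) u : linear (fun v => g x u v : R^o).
Proof. by move=> k v w; rewrite metric_linear. Qed.

Lemma metric_linearl (x : G) v : linear (fun u => g x u v : R^o).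
Proof. by move=> k u w; rewrite !(metric_sym _ _ _ v) metric_linear. Qed.

Lemma metric_inj (x : G) X X' : (forall Y, g x X Y = g x X' Y) -> X = X'.
Proof.
move=> E; apply/eqP; rewrite -subr_eq0; apply/negPn/negP => /(metric_pos g x).
have /= := metric_linearl x (X - X') (-1) X' X.
rewrite scaleN1r [- X' + X]addrC => -> /=.
by rewrite E scaleN1r addNr ltxx.
Qed.

(** The function [<Ad_r X, Ad_r X>] of [r] is constant, and its derivative at the identity is twice
    this pairing. *)
Lemma metric_ad_self X Z : bi_invariant g -> g 1%g X (ad G Z X) = 0.
Proof.
move=> gi.
pose e0 := chart (1%g : G) (1%g : G).
have dAd := is_diff_Ad_one G X.
have Ad0 : Ad (chart_inv (1%g : G) e0) X = X by rewrite chart_inv_center Ad1.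
have dB N : is_diff e0 (fun r => g 1%g (Ad (chart_inv (1%g : G) r) X) N : R^o)
    (fun a => g 1%g (ad G a X) N).
  exact: (is_diff_comp_at dAd (is_diff_linear_mx _ (metric_linearl 1%g N)) erefl).
have lB r : linear (fun N => g 1%g (Ad (chart_inv (1%g : G) r) X) N : R^o).
  exact: metric_linearr.
have D := is_diff_apply lB dB dAd Ad0.
have E : \forall r \near e0, g 1%g X X =
    g 1%g (Ad (chart_inv (1%g : G) r) X) (Ad (chart_inv (1%g : G) r) X).
  by near=> r; rewrite bi_invariant_Ad.
have := is_diff_unique E (is_diff_zero (g 1%g X X : R^o) e0) D Z.
rewrite /= Ad0 metric_sym => /eqP.
by rewrite -mulr2n mulrn_eq0 /= => /eqP.
Unshelve. all: by end_near. Qed.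

Lemma is_diff_dpair2 (V : normedModType R) (f df : V -> 'cV[R]_n)
    (h dh : V -> 'rV[R]_n) z : is_diff z f df -> is_diff z h dh ->
  is_diff z (fun t => dpair (f t) (h t) : R^o)
    (fun w => dpair (f z) (dh w) + dpair (df w) (h z)).
Proof.
move=> df' dh'.
have dB N : is_diff z (fun t => dpair N (h t) : R^o) (fun w => dpair N (dh w)).
  exact: (is_diff_comp_at dh' (is_diff_linear_mx _ (dpair_linearr N)) erefl).
exact: (is_diff_apply (fun t => dpair_linearl (h t)) dB df' erefl).
Qed.

Section Sharp.
Variables (A : 'I_n -> 'rV[R]_n) (A_basis : orthonormal_basis g A).

(** Orthonormality makes the sum of the [xi(A_i) A_i] represent [xi], so the default [0] in [sharp]
    is never what defines it. *)
Lemma sharpP xi Y : dpair xi Y = g 1%g (sharp g xi) Y.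
Proof.
suff : [set X | forall Y, dpair xi Y = g 1%g X Y] (sharp g xi) by apply.
apply: xgetPex; have [bA oA] := A_basis.
exists (\sum_i dpair xi (A i) *: A i) => {}Y.
have YE : Y = \sum_i coord [tuple A i | i < n] i Y *: A i.
  rewrite {1}(coord_basis bA (memvf Y)); apply: eq_bigr => i _.
  by rewrite -tnth_nth tnth_mktuple.
rewrite YE (linear_lincomb (dpair_linearr xi)) (linear_lincomb (metric_linearr 1%g _)).
apply: eq_bigr => i _; rewrite (linear_lincomb (metric_linearl 1%g (A i))).
rewrite (bigD1 i) //= big1 ?addr0 => [|j ji].
  by rewrite oA eqxx [_ *: 1]mulr1.
by rewrite oA (negbTE ji) scaler0.
Qed.

Lemma sharp_linear : linear (sharp g).
Proof.
move=> k xi xi'; apply: (@metric_inj 1%g) => Y.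
by rewrite metric_linearl -!sharpP dpair_linearl.
Qed.

Lemma is_diff_energy (p : ambient) : is_diff p (energy g : ambient -> R^o)
  (fun u => dpair u.1.1 p.1.2 + dpair p.1.1 u.1.2 + dpair u.2 (sharp g p.2)).
Proof.
have d1 := is_diff_comp_at (is_diff_fst p) (is_diff_fst p.1) erefl.
have d2 := is_diff_comp_at (is_diff_fst p) (is_diff_snd p.1) erefl.
have d3 := is_diff_snd p.
have d4 := is_diff_comp_at d3 (is_diff_linear_mx _ sharp_linear) erefl.
have D := is_diffD (is_diff_dpair2 d1 d2) (is_diffZ (2^-1) (is_diff_dpair2 d3 d4)).
have E : (energy g : ambient -> R^o) = (fun q : ambient => dpair q.1.1 q.1.2 : R^o) +
    2^-1 *: (fun q : ambient => dpair q.2 (sharp g q.2) : R^o).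
  by apply/funext => -[[]].
rewrite E; have := D; congr is_diff_def; apply/funext => u /=.
rewrite -[LHS]/(dpair p.1.1 u.1.2 + dpair u.1.1 p.1.2 +
  2^-1 * (dpair p.2 (sharp g u.2) + dpair u.2 (sharp g p.2))).
(* Symmetry of the metric makes both product-rule terms of the kinetic part equal, which absorbs the
   factor one half. *)
rewrite (_ : dpair p.2 (sharp g u.2) = dpair u.2 (sharp g p.2)); last first.
  by rewrite !sharpP metric_sym.
by field.
Qed.

End Sharp.

Lemma is_diff_integral_fun (A : 'I_n -> 'rV[R]_n) i (p : ambient) :
  is_diff p (integral_fun G A i : ambient -> R^o)
  (fun u => dpair (u.1.1 + (coad G u.1.2 p.2 + coad G p.1.2 u.2)) (A i)).
Proof.
have d1 := is_diff_comp_at (is_diff_fst p) (is_diff_fst p.1) erefl.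
have d2 := is_diff_comp_at (is_diff_fst p) (is_diff_snd p.1) erefl.
have D := is_diff_comp_at (is_diffD d1 (is_diff_coad G d2 (is_diff_snd p)))
  (is_diff_linear_mx _ (dpair_linearl (A i))) erefl.
have := D; congr is_diff_def; apply/funext => q.
by case: q => -[[]].
Qed.

End Metric.

(** * Hamilton's equations and conservation of the integrals *)

Theorem proposition5 (R : realType) (n : nat) (G : lieGroupType R n)
    (compactG : compact [set: G]) (connectedG : connected [set: G])
    (semisimpleG : semisimple G)
    (g : riemannian_metric G) (g_biinv : bi_invariant g)
    (A : 'I_n -> 'rV[R]_n) (A_basis : orthonormal_basis g A)
    (eta : 'cV[R]_n)
    (X_h : 'cV[R]_n * 'rV[R]_n * 'cV[R]_n -> 'cV[R]_n * 'rV[R]_n * 'cV[R]_n)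
    (X_h_hamiltonian : hamiltonian_vector_field G eta (energy g) X_h)
    (i : 'I_n) (p : 'cV[R]_n * 'rV[R]_n * 'cV[R]_n) :
  phase_space G eta p ->
  'd (integral_fun G A i : 'cV[R]_n * 'rV[R]_n * 'cV[R]_n -> R^o) p (X_h p) = 0.
Proof.
move=> ph; have [tX HX] := X_h_hamiltonian p ph.
apply: etrans (diff_eqf (X_h p) (is_diff_integral_fun G A i p)) _.
have dE := is_diff_energy A_basis p.
case: p (X_h p) ph tX HX dE => [[theta Y] xi] [[delta U] zeta] ph tX HX dE /=.
(* Hamilton's equation tested on an arbitrary tangent vector. Keeping only [zeta'], only [U'] or
   only [Z'] isolates [U], [zeta] and [delta] respectively. *)
have ham Z' U' zeta' : - dpair delta Z' + dpair zeta' U - dpair zeta U' =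
    dpair (coad G Z' theta) Y + dpair theta U' + dpair zeta' (sharp g xi).
  have := HX (coad G Z' theta, U', zeta').
  have [x _ /= xth] := ph.
  rewrite (Omega_barE Y xi U zeta Z' U' zeta' ph tX) => -> /=.
    exact: (diff_eqf _ dE).
  by rewrite /phase_tangent /= -xth; exact: coad_orbit_tangent.
have coad0 : coad G 0 theta = 0.
  have := coad_linearl G theta 1 0 0; rewrite scaler0 addr0 scale1r => /eqP.
  by rewrite -subr_eq0 opprD addNKr oppr_eq0 => /eqP.
have UE : U = sharp g xi.
  apply/rowP => j; have := ham 0 0 (delta_mx j 0).
  by rewrite !(coad0, dpair0l, dpair0r) oppr0 !addr0 !add0r /dpair -!colE !mxE.
have zetaE : zeta = - theta.
  apply: dpair_inj => Z; have := ham 0 Z 0.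
  rewrite !(coad0, dpair0l, dpair0r) oppr0 !add0r addr0 => E.
  by rewrite dpairNl -E opprK.
have deltaE : delta = coad G Y theta.
  apply: dpair_inj => Z; have := ham Z 0 0.
  rewrite !(dpair0l, dpair0r) subr0 !addr0 dpair_coad_anti => /eqP.
  by rewrite eqr_opp => /eqP.
(* The orbit component [ad^*_Y theta] cancels against the contribution of [zeta = - theta] through
   [ad^*_Y], and only the term in [U = X_xi] survives. *)
rewrite UE zetaE deltaE !dpairDl.
have -> : dpair (coad G Y (- theta)) (A i) = - dpair (coad G Y theta) (A i).
  by rewrite !dpair_coad dpairNl.
rewrite addrCA subrr addr0 dpair_coad ad_anti dpairNr (sharpP A_basis).
by rewrite metric_ad_self // oppr0.
Qed.
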